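(* Let $X$ be a simply connected rationally elliptic space. For any real $\varepsilon>0$ and any integer $r\ge \mathfrak{pp}(X;\varepsilon)$ we have $$r\left(\sum_{i=2}^{n}\dim\left(\pi_i(X)\otimes\mathbb{Q}\right)\varepsilon^i\right)<\left(1+\sum_{i=2}^{l}\dim H^i(X;\mathbb{Q})\,\varepsilon^i\right)^{r},$$ where $n$ (resp. $l$) is the degree of the homotopical Poincaré polynomial $P^{\pi}_X$ (resp. the cohomological Poincaré polynomial $P_X$), empty sums being zero.
   Context: A rationally elliptic space is a simply connected topological space $X$ such that $\dim(\pi_*(X)\otimes\mathbb{Q})<\infty$ and $\dim H^*(X;\mathbb{Q})<\infty$ (total dimensions over all degrees). Its cohomological and homotopical Poincaré polynomials are $$P_X(t):=\sum_{k\ge 0}\dim H^k(X;\mathbb{Q})\,t^k,\qquad P^{\pi}_X(t):=\sum_{k\ge 2}\dim(\pi_k(X)\otimes\mathbb{Q})\,t^k.$$ $X^n$ is the Cartesian product of $n$ copies of $X$. For a real number $\varepsilon>0$, the stabilization threshold $\mathfrak{pp}(X;\varepsilon)$ is the smallest positive integer $n_0$ such that for all integers $n\ge n_0$ one has $P^{\pi}_{X^n}(t)<P_{X^n}(t)$ for all real $t\ge\varepsilon$ (such an integer always exists). *)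

(* Defs.v *)
From HB Require Import structures.
From mathcomp Require Import all_boot all_order all_algebra generic_quotient.
From mathcomp Require Import all_classical all_reals all_analysis.
Import numFieldNormedType.Exports.
Import Order.TTheory GRing.Theory Num.Theory.

Set Implicit Arguments.
Unset Strict Implicit.
Unset Printing Implicit Defensive.

Local Open Scope classical_set_scope.
Local Open Scope ring_scope.
Local Open Scope quotient_scope.

Section Dimension.
Variables (K : fieldType) (V : lmodType K).
Implicit Types (S U W : set V).

Definition linear_span S : set V :=
  [set v | exists (n : nat) (a : 'I_n -> K) (s : 'I_n -> V),
     (forall i, S (s i)) /\ v = \sum_(i < n) a i *: s i].

(* For submodules W of U: the quotient U / W has dimension d, i.e. the classes
   of some e_0, ..., e_(d-1) in U form a basis of U / W. *)
Definition has_dim_quot U W (d : nat) : Prop :=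
  exists e : 'I_d -> V, (forall i, U (e i)) /\
    forall u, U u ->
      exists! a : 'rV[K]_d, W (u - \sum_(i < d) a ord0 i *: e i).

Definition finite_dim_quot U W : Prop := exists d, has_dim_quot U W d.

(* Equal to 0 by convention if U / W is infinite-dimensional. *)
Definition dim_quot U W : nat := xget 0%N [set d | has_dim_quot U W d].

End Dimension.

Section Rationalization.
Variables (G : choiceType) (mul : G -> G -> G).

Definition free_gen (g : G) : G -> rat^o := fun h => (h == g)%:R.

Definition finsupp_fun : set (G -> rat^o) :=
  [set c | finite_set [set g | c g != 0]].

Definition rat_relators : set (G -> rat^o) :=
  linear_span [set c | exists g h : G,
    c = free_gen (mul g h) - free_gen g - free_gen h].

(* For an abelian group G, the tensor product of G with the rationals is the
   rational vector space generated by the symbols [g], for g in G, subject to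
   the relations [g h] = [g] + [h]; here [g] stands for the tensor of g and 1. *)
Definition rat_tensor_findim : Prop :=
  finite_dim_quot finsupp_fun rat_relators.

Definition rat_tensor_dim : nat := dim_quot finsupp_fun rat_relators.

End Rationalization.

Section Spaces.
Variable R : realType.

Definition unit_interval : set R := `[0, 1].

Definition cube (k : nat) : set 'rV[R]_k :=
  [set x | forall i, 0 <= x ord0 i <= 1].

Arguments cube : clear implicits.

Definition cube_boundary (k : nat) (x : cube k) : Prop :=
  exists i, \val x ord0 i = 0 \/ \val x ord0 i = 1.

Definition simplex (k : nat) : set 'rV[R]_k.+1 :=
  [set x | (forall i, 0 <= x ord0 i) /\ \sum_i x ord0 i = 1].
Arguments simplex : clear implicits.

Lemma continuous_compose (T U V : topologicalType) (g : U -> V) (f : T -> U) :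
  continuous g -> continuous f -> continuous (fun t => g (f t)).
Proof. by move=> cg cf t; apply: continuous_comp; [exact: cf|exact: cg]. Qed.

Lemma continuous_set_type (T U : topologicalType) (A : set U) (f : T -> A) :
  continuous (fun t => \val (f t)) -> continuous f.
Proof. by move=> cf; apply: (@continuous_comp_initial _ _ _ set_val). Qed.

Lemma continuous_val (U : topologicalType) (A : set U) :
  continuous (fun x : A => \val x).
Proof. exact: (@initial_continuous _ _ set_val). Qed.

Lemma continuous_rV (T : topologicalType) k (f : T -> 'rV[R]_k) :
  (forall i, continuous (fun t => f t ord0 i)) -> continuous f.
Proof.
move=> cf t B [P Pft PB].
have : \forall t' \near t, forall i, P ord0 i (f t' ord0 i).
  by apply: filter_forall => i; exact: (cf i t _ (Pft ord0 i)).
by apply: filterS => t' Pt'; apply: PB => i j; rewrite (ord1 i); exact: Pt'.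
Qed.

Lemma continuous_coord k (A : set 'rV[R]_k) i :
  continuous (fun x : A => \val x ord0 i).
Proof.
apply: (continuous_compose (g := fun y : 'rV[R]_k => y ord0 i)).
  exact: coord_continuous.
exact: continuous_val.
Qed.

Lemma continuous_paste (T X : topologicalType) (r : T -> R) (f g : T -> X) :
  continuous r -> continuous f -> continuous g ->
  (forall t, r t = 2^-1 -> f t = g t) ->
  continuous (fun t => if r t <= 2^-1 then f t else g t).
Proof.
move=> cr cf cg fg.
pose h t := if r t <= 2^-1 then f t else g t; rewrite -/h.
have clA : closed (r @^-1` [set x | x <= 2^-1]).
  by apply: preimage_closed (@closed_le _ _) => t _; exact: cr.
have clB : closed (r @^-1` [set x | 2^-1 <= x]).
  by apply: preimage_closed (@closed_ge _ _) => t _; exact: cr.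
suff : {within (r @^-1` [set x | x <= 2^-1]) `|` (r @^-1` [set x | 2^-1 <= x]),
    continuous h}.
  move=> ch; apply/continuous_subspace_setT; move: ch.
  rewrite (_ : _ `|` _ = setT) //.
  by apply/seteqP; split=> // t _ /=; case: (leP (r t) 2^-1) => [|/ltW]; auto.
apply: withinU_continuous => //.
- apply: (@subspace_eq_continuous _ _ _ f); last exact: continuous_subspaceT.
  by move=> t /set_mem /= rt; rewrite /from_subspace /h /= rt.
- apply: (@subspace_eq_continuous _ _ _ g); last exact: continuous_subspaceT.
  move=> t /set_mem /= rt; rewrite /from_subspace /h /=; case: ifPn => // rt'.
  by rewrite fg //; apply/eqP; rewrite eq_le rt rt'.
Qed.

Definition lhalf (t : R) : R := Num.min (t + t) 1.
Definition rhalf (t : R) : R := Num.max (t + t - 1) 0.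

Lemma lhalf01 t : 0 <= t <= 1 -> 0 <= lhalf t <= 1.
Proof.
move=> /andP[t0 _]; rewrite /lhalf le_min ge_min ler01 lexx orbT !andbT.
exact: addr_ge0.
Qed.

Lemma rhalf01 t : 0 <= t <= 1 -> 0 <= rhalf t <= 1.
Proof.
move=> /andP[t0 t1]; rewrite /rhalf le_max ge_max lexx ler01 orbT andbT /=.
by rewrite lerBlDr lerD.
Qed.

Lemma lhalf_half : lhalf 2^-1 = 1.
Proof.
by rewrite /lhalf -[X in _ + X]div1r -[X in X + _]div1r -splitr minxx.
Qed.

Lemma rhalf_half : rhalf 2^-1 = 0.
Proof.
by rewrite /rhalf -[X in _ + X - _]div1r -[X in X + _ - _]div1r -splitr subrr maxxx.
Qed.

Lemma lhalf0 : lhalf 0 = 0.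
Proof. by rewrite /lhalf addr0 min_l. Qed.

Lemma rhalf1 : rhalf 1 = 1.
Proof. by rewrite /rhalf addrK max_l. Qed.

Lemma lhalf_continuous : continuous lhalf.
Proof.
move=> t; apply: (@continuous_min _ _ (fun t : R => t + t) (cst 1));
  last exact: cvg_cst.
by apply: cvgD; exact: cvg_id.
Qed.

Lemma rhalf_continuous : continuous rhalf.
Proof.
move=> t; apply: (@continuous_max _ _ (fun t : R => t + t - 1) (cst 0));
  last exact: cvg_cst.
by apply: cvgB; [apply: cvgD; exact: cvg_id|exact: cvg_cst].
Qed.

Section Reparametrization.
Variables (h : R -> R).
Hypothesis h01 : forall t, 0 <= t <= 1 -> 0 <= h t <= 1.
Hypothesis h_continuous : continuous h.

Lemma interval_map_subproof (s : unit_interval) :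
  h (\val s) \in unit_interval.
Proof.
by apply/mem_set; rewrite /unit_interval /= in_itv /=; apply: h01;
  have := set_mem (valP s); rewrite /unit_interval /= in_itv.
Qed.

Definition interval_map (s : unit_interval) : unit_interval :=
  exist _ (h (\val s)) (interval_map_subproof s).

Lemma interval_map_continuous : continuous interval_map.
Proof.
apply: continuous_set_type.
exact: (continuous_compose h_continuous (@continuous_val _ _)).
Qed.

Lemma cube_map_subproof k (x : cube k.+1) :
  \row_i (if i == ord0 then h (\val x ord0 i) else \val x ord0 i)
    \in cube k.+1.
Proof.
apply/mem_set => i; rewrite mxE; have xi := set_mem (valP x) i.
by case: ifP => // _; exact: h01.
Qed.

Definition cube_map k (x : cube k.+1) : cube k.+1 :=
  exist (fun y => y \in cube k.+1) _ (cube_map_subproof x).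

Lemma cube_map0 k (x : cube k.+1) :
  \val (cube_map x) ord0 ord0 = h (\val x ord0 ord0).
Proof. by rewrite mxE eqxx. Qed.

Lemma cube_map_neq0 k (x : cube k.+1) i :
  i != ord0 -> \val (cube_map x) ord0 i = \val x ord0 i.
Proof. by move=> /negbTE i0; rewrite mxE i0. Qed.

Lemma cube_map_continuous k : continuous (@cube_map k).
Proof.
apply: continuous_set_type; apply: continuous_rV => i x /=.
have [->|i0] := eqVneq i ord0.
  under eq_fun do rewrite mxE eqxx.
  exact: (continuous_compose h_continuous (@continuous_coord _ _ _)).
under eq_fun do rewrite mxE (negbTE i0).
exact: continuous_coord.
Qed.

End Reparametrization.

End Spaces.
Arguments unit_interval : clear implicits.
Arguments cube : clear implicits.
Arguments simplex : clear implicits.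

Section HomotopyGroups.
Variables (R : realType) (X : topologicalType) (x0 : X).

Definition based_map (k : nat) : set (continuousType (cube R k) X) :=
  [set f | forall x, cube_boundary x -> f x = x0].
Arguments based_map : clear implicits.

Definition based_homotopic (k : nat) (f g : based_map k) : Prop :=
  exists H : unit_interval R * cube R k -> X,
    [/\ continuous H,
        forall (s : unit_interval R) x, \val s = 0 -> H (s, x) = \val f x,
        forall (s : unit_interval R) x, \val s = 1 -> H (s, x) = \val g x &
        forall s x, cube_boundary x -> H (s, x) = x0].

Lemma based_homotopic_refl k (f : based_map k) : based_homotopic f f.
Proof.
exists (fun sx => \val f sx.2); split=> //.
- apply: (continuous_compose (g := \val f)); first exact: cts_fun.
  by move=> sx; exact: cvg_snd.
- by move=> s x; exact: (set_mem (valP f)).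
Qed.

Lemma interval_rev_subproof (s : unit_interval R) :
  1 - \val s \in unit_interval R.
Proof.
apply/mem_set; have := set_mem (valP s).
by rewrite /unit_interval /= !in_itv /= subr_ge0 lerBlDr lerDl andbC.
Qed.

Definition interval_rev (s : unit_interval R) : unit_interval R :=
  exist _ (1 - \val s) (interval_rev_subproof s).

Lemma continuous_pairing (T U V : topologicalType) (f : T -> U) (g : T -> V) :
  continuous f -> continuous g -> continuous (fun t => (f t, g t)).
Proof. by move=> cf cg t; apply: cvg_pair; [exact: cf|exact: cg]. Qed.

Lemma continuous_fst (U V : topologicalType) : continuous (@fst U V).
Proof. by move=> p; exact: cvg_fst. Qed.

Lemma continuous_snd (U V : topologicalType) : continuous (@snd U V).
Proof. by move=> p; exact: cvg_snd. Qed.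

Lemma based_homotopic_sym k (f g : based_map k) :
  based_homotopic f g -> based_homotopic g f.
Proof.
move=> [H [cH H0 H1 Hb]]; exists (fun sx => H (interval_rev sx.1, sx.2)).
split.
- apply: (continuous_compose cH); apply: continuous_pairing.
    apply: (continuous_compose (g := interval_rev)); last exact: continuous_fst.
    apply: continuous_set_type.
    apply: (continuous_compose (g := fun r : R => 1 - r)).
      by move=> r; apply: cvgB; [exact: cvg_cst|exact: cvg_id].
    exact: continuous_val.
  exact: continuous_snd.
- by move=> s x s0; rewrite H1 //= s0 subr0.
- by move=> s x s1; rewrite H0 //= s1 subrr.
- by move=> s x; exact: Hb.
Qed.

Definition interval_lhalf := interval_map (@lhalf01 R).
Definition interval_rhalf := interval_map (@rhalf01 R).

Lemma interval_lhalf_continuous : continuous interval_lhalf.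
Proof. exact: interval_map_continuous (@lhalf_continuous R). Qed.

Lemma interval_rhalf_continuous : continuous interval_rhalf.
Proof. exact: interval_map_continuous (@rhalf_continuous R). Qed.

Lemma half_lt1 : (2^-1 : R) < 1.
Proof. by rewrite invf_lt1 // ltr1n. Qed.

Lemma based_homotopic_trans k (f g h : based_map k) :
  based_homotopic f g -> based_homotopic g h -> based_homotopic f h.
Proof.
move=> [H [cH H0 H1 Hb]] [K [cK K0 K1 Kb]].
exists (fun sx : unit_interval R * cube R k =>
  if \val sx.1 <= 2^-1 then H (interval_lhalf sx.1, sx.2)
                  else K (interval_rhalf sx.1, sx.2)); split.
- apply: (@continuous_paste R _ _ (fun sx : unit_interval R * cube R k => \val sx.1)
    (fun sx => H (interval_lhalf sx.1, sx.2))
    (fun sx => K (interval_rhalf sx.1, sx.2))).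
  + exact: (continuous_compose (@continuous_val _ _) (@continuous_fst _ _)).
  + apply: (continuous_compose cH); apply: continuous_pairing.
      exact: (continuous_compose interval_lhalf_continuous (@continuous_fst _ _)).
    exact: continuous_snd.
  + apply: (continuous_compose cK); apply: continuous_pairing.
      exact: (continuous_compose interval_rhalf_continuous (@continuous_fst _ _)).
    exact: continuous_snd.
  + by move=> sx sxE; rewrite H1 ?K0 //= sxE ?lhalf_half ?rhalf_half.
- by move=> s x s0 /=; rewrite s0 invr_ge0 ler0n H0 //= s0 lhalf0.
- by move=> s x s1 /=; rewrite s1 leNgt half_lt1 /= K1 //= s1 rhalf1.
- by move=> s x xb /=; case: ifP => _; [exact: Hb|exact: Kb].
Qed.

Definition based_homotopicb (k : nat) (f g : based_map k) : bool :=
  `[< based_homotopic f g >].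

Lemma based_homotopicb_refl k : reflexive (@based_homotopicb k).
Proof. by move=> f; apply/asboolP; exact: based_homotopic_refl. Qed.

Lemma based_homotopicb_sym k : symmetric (@based_homotopicb k).
Proof. by move=> f g; apply/asboolP/asboolP; exact: based_homotopic_sym. Qed.

Lemma based_homotopicb_trans k : transitive (@based_homotopicb k).
Proof.
move=> g f h /asboolP fg /asboolP gh; apply/asboolP.
exact: based_homotopic_trans fg gh.
Qed.

Canonical based_homotopic_equiv k :=
  EquivRel (@based_homotopicb k) (@based_homotopicb_refl k)
    (@based_homotopicb_sym k) (@based_homotopicb_trans k).

(* The underlying set of pi_k(X, x0), based at x0; see homotopy_mul for the
   group law in degrees k > 0. *)
Definition homotopy_group (k : nat) : Type :=
  {eq_quot (based_homotopic_equiv k)}.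

HB.instance Definition _ k := Choice.on (homotopy_group k).
HB.instance Definition _ k := EqQuotient.on (homotopy_group k).

Definition cube_lhalf k := @cube_map R _ (@lhalf01 R) k.
Definition cube_rhalf k := @cube_map R _ (@rhalf01 R) k.

Lemma cube_lhalf_continuous k : continuous (@cube_lhalf k).
Proof. exact: (@cube_map_continuous R _ (@lhalf01 R) (@lhalf_continuous R) k). Qed.

Lemma cube_rhalf_continuous k : continuous (@cube_rhalf k).
Proof. exact: (@cube_map_continuous R _ (@rhalf01 R) (@rhalf_continuous R) k). Qed.

Lemma cube_lhalf_boundary k (x : cube R k.+1) :
  \val x ord0 ord0 = 2^-1 -> cube_boundary (cube_lhalf x).
Proof. by move=> xE; exists ord0; right; rewrite cube_map0 xE lhalf_half. Qed.

Lemma cube_rhalf_boundary k (x : cube R k.+1) :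
  \val x ord0 ord0 = 2^-1 -> cube_boundary (cube_rhalf x).
Proof. by move=> xE; exists ord0; left; rewrite cube_map0 xE rhalf_half. Qed.

Lemma cube_half_boundary k (x : cube R k.+1) : cube_boundary x ->
  cube_boundary (if \val x ord0 ord0 <= 2^-1 then cube_lhalf x
                 else cube_rhalf x).
Proof.
move=> [i]; have [->|i0] := eqVneq i ord0; last first.
  move=> xi; exists i; case: ifP => _; rewrite cube_map_neq0 //.
move=> [] x0E; rewrite x0E.
  by rewrite invr_ge0 ler0n; exists ord0; left; rewrite cube_map0 x0E lhalf0.
by rewrite leNgt half_lt1 /=; exists ord0; right; rewrite cube_map0 x0E rhalf1.
Qed.

Definition concat_fun k (f g : cube R k.+1 -> X) (x : cube R k.+1) : X :=
  if \val x ord0 ord0 <= 2^-1 then f (cube_lhalf x) else g (cube_rhalf x).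

Lemma concat_fun_continuous k (f g : based_map k.+1) :
  continuous (concat_fun (\val f) (\val g)).
Proof.
apply: (@continuous_paste R _ _ (fun x : cube R k.+1 => \val x ord0 ord0)
  (fun x => \val f (cube_lhalf x)) (fun x => \val g (cube_rhalf x))).
- exact: continuous_coord.
- by apply: continuous_compose; [exact: cts_fun|exact: cube_lhalf_continuous].
- by apply: continuous_compose; [exact: cts_fun|exact: cube_rhalf_continuous].
- move=> x xE; rewrite (set_mem (valP f)) ?(set_mem (valP g)) //.
    exact: cube_rhalf_boundary.
  exact: cube_lhalf_boundary.
Qed.

Lemma concat_subproof k (f g : based_map k.+1) :
  (mkcts (@concat_fun_continuous k f g) : continuousType _ _)
    \in based_map k.+1.
Proof.
apply/mem_set => x /cube_half_boundary xb.
change (concat_fun (\val f) (\val g) x = x0); move: xb; rewrite /concat_fun.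
by case: ifP => _ xb;
  [exact: (set_mem (valP f) _ xb)|exact: (set_mem (valP g) _ xb)].
Qed.

Definition concat k (f g : based_map k.+1) : based_map k.+1 :=
  exist (fun h => h \in based_map k.+1) _ (concat_subproof f g).

Lemma concatE k (f g : based_map k.+1) x :
  \val (concat f g) x = if \val x ord0 ord0 <= 2^-1 then \val f (cube_lhalf x)
                        else \val g (cube_rhalf x).
Proof. by []. Qed.

Lemma concat_homotopic k (f f' g g' : based_map k.+1) :
  based_homotopic f f' -> based_homotopic g g' ->
  based_homotopic (concat f g) (concat f' g').
Proof.
move=> [H [cH H0 H1 Hb]] [K [cK K0 K1 Kb]].
exists (fun sx : unit_interval R * cube R k.+1 =>
  if \val sx.2 ord0 ord0 <= 2^-1 then H (sx.1, cube_lhalf sx.2)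
                  else K (sx.1, cube_rhalf sx.2)); split.
- apply: (@continuous_paste R _ _
    (fun sx : unit_interval R * cube R k.+1 => \val sx.2 ord0 ord0)
    (fun sx => H (sx.1, cube_lhalf sx.2))
    (fun sx => K (sx.1, cube_rhalf sx.2))).
  + exact: (continuous_compose (@continuous_coord _ _ _ _) (@continuous_snd _ _)).
  + apply: (continuous_compose cH); apply: continuous_pairing.
      exact: continuous_fst.
    exact: (continuous_compose (@cube_lhalf_continuous _) (@continuous_snd _ _)).
  + apply: (continuous_compose cK); apply: continuous_pairing.
      exact: continuous_fst.
    exact: (continuous_compose (@cube_rhalf_continuous _) (@continuous_snd _ _)).
  + move=> [s x] /= xE; rewrite Hb ?Kb //.
      exact: cube_rhalf_boundary.
    exact: cube_lhalf_boundary.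
- by move=> s x s0; rewrite concatE /=; case: ifP; rewrite ?H0 ?K0.
- by move=> s x s1; rewrite concatE /=; case: ifP; rewrite ?H1 ?K1.
- move=> s x /cube_half_boundary /=.
  by case: ifP => _ xb; [exact: Hb|exact: Kb].
Qed.

Definition homotopy_mul k (a b : homotopy_group k.+1) : homotopy_group k.+1 :=
  \pi_(homotopy_group k.+1) (concat (repr a) (repr b)).

Lemma homotopy_classP k (f g : based_map k) :
  \pi_(homotopy_group k) f = \pi_(homotopy_group k) g <-> based_homotopic f g.
Proof.
by split=> [/eqquotP/asboolP|fg]; [|apply/eqquotP/asboolP].
Qed.

Lemma homotopy_mulE k (f g : based_map k.+1) :
  homotopy_mul (\pi_(homotopy_group k.+1) f) (\pi_(homotopy_group k.+1) g) =
    \pi_(homotopy_group k.+1) (concat f g).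
Proof.
by apply/homotopy_classP; apply: concat_homotopic; apply/homotopy_classP;
  rewrite reprK.
Qed.

End HomotopyGroups.
Arguments based_map R {X} x0 k.
Arguments homotopy_group R {X} x0 k.
Arguments homotopy_mul {R X x0 k} a b.

Section SingularCohomology.
Variables (R : realType) (X : topologicalType).

Lemma face_subproof k (i : 'I_k.+2) (x : simplex R k) :
  \row_j (if unlift i j is Some j' then \val x ord0 j' else 0)
    \in simplex R k.+1.
Proof.
have [x_ge0 x_sum] := set_mem (valP x); apply/mem_set; split=> [j|].
  by rewrite mxE; case: (unlift i j) => [j'|]; rewrite ?x_ge0 ?lexx.
rewrite (bigD1 i) //= mxE unlift_none add0r -[RHS]x_sum.
rewrite (reindex_omap (lift i) (unlift i)) /=; last first.
  by move=> j ji; case: unliftP => [j' -> //|jE]; rewrite jE eqxx in ji.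
apply: eq_big => [j|j _]; first by rewrite eq_sym neq_lift liftK eqxx.
by rewrite mxE liftK.
Qed.

(* The i-th face of the standard simplex: insertion of a 0 at index i. *)
Definition face k (i : 'I_k.+2) (x : simplex R k) : simplex R k.+1 :=
  exist (fun y => y \in simplex R k.+1) _ (face_subproof i x).

Lemma face_continuous k (i : 'I_k.+2) : continuous (@face k i).
Proof.
apply: continuous_set_type; apply: continuous_rV => j /=.
under eq_fun do rewrite mxE.
case: (unlift i j) => [j'|]; last exact: cst_continuous.
exact: continuous_coord.
Qed.

HB.instance Definition _ k (i : 'I_k.+2) :=
  @isContinuous.Build _ _ (@face k i) (@face_continuous k i).

Definition singular_simplex (k : nat) : Type := continuousType (simplex R k) X.

Definition simplex_face k (i : 'I_k.+2) (s : singular_simplex k.+1) :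
  singular_simplex k := [the continuousType _ _ of s \o @face k i].

Local Notation cochain k := (singular_simplex k -> rat^o).

Definition coboundary k (c : cochain k) : cochain k.+1 :=
  fun s => \sum_(i < k.+2) (-1) ^+ i * c (simplex_face i s).

Definition cocycles k : set (cochain k) := [set c | coboundary c = 0].

Definition coboundaries k : set (cochain k) :=
  if k is k'.+1 then range (@coboundary k') else [set 0].

End SingularCohomology.

Definition cohomology_findim (R : realType) (X : topologicalType) (k : nat) :=
  finite_dim_quot (@cocycles R X k) (@coboundaries R X k).

Definition cohomology_dim (R : realType) (X : topologicalType) (k : nat) : nat :=
  dim_quot (@cocycles R X k) (@coboundaries R X k).

(* Only positive degrees carry a group structure; degree 0 is set to 0. *)
Definition homotopy_findim (R : realType) (X : topologicalType) (x0 : X)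
    (k : nat) : Prop :=
  if k is k'.+1 then rat_tensor_findim (@homotopy_mul R X x0 k') else True.

Definition homotopy_dim (R : realType) (X : topologicalType) (x0 : X)
    (k : nat) : nat :=
  if k is k'.+1 then rat_tensor_dim (@homotopy_mul R X x0 k') else 0%N.

Definition path_connected (R : realType) (X : topologicalType) : Prop :=
  forall x y : X, exists p : continuousType (unit_interval R) X,
    forall s : unit_interval R,
      (\val s = 0 -> p s = x) /\ (\val s = 1 -> p s = y).

Definition simply_connected (R : realType) (X : topologicalType) : Prop :=
  [/\ inhabited X, path_connected R X &
      forall (x0 : X) (a b : homotopy_group R x0 1), a = b].

Definition finite_total_dim (findim : nat -> Prop) (dim : nat -> nat) : Prop :=
  (forall k, findim k) /\
  exists N : nat, forall m : nat, (\sum_(k < m) dim k <= N)%N.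

Definition rationally_elliptic (R : realType) (X : topologicalType) : Prop :=
  [/\ simply_connected R X,
      forall x0 : X,
        finite_total_dim (homotopy_findim R x0) (homotopy_dim R x0) &
      finite_total_dim (cohomology_findim R X) (cohomology_dim R X)].

(* The polynomial with coefficients a_0, a_1, ..., provided that almost all of
   them vanish; 0 by convention otherwise. *)
Definition gen_poly (R : realType) (a : nat -> nat) : {poly R} :=
  xget 0 [set p : {poly R} | forall k, p`_k = (a k)%:R].

Definition poincare_poly (R : realType) (X : topologicalType) : {poly R} :=
  gen_poly R (cohomology_dim R X).

(* For a simply connected space the base point is irrelevant. *)
Definition homotopical_poincare_poly (R : realType) (X : topologicalType)
    (x0 : X) : {poly R} :=
  gen_poly R (fun k => if (2 <= k)%N then homotopy_dim R x0 k else 0%N).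

Definition cartesian_power (X : topologicalType) (n : nat) : topologicalType :=
  prod_topology (fun _ : 'I_n => X).

Definition diag_point (X : topologicalType) (x0 : X) (n : nat) :
  cartesian_power X n := fun=> x0.
Arguments diag_point {X} x0 n.

Definition dominated_from (R : realType) (X : topologicalType) (x0 : X)
    (eps : R) (n0 : nat) : Prop :=
  forall n, (n0 <= n)%N -> forall t : R, eps <= t ->
    (homotopical_poincare_poly R (diag_point x0 n)).[t] <
    (poincare_poly R (cartesian_power X n)).[t].

(* pp(X; eps) = n0; this determines n0 uniquely. *)
Definition is_stabilization_threshold (R : realType) (X : topologicalType)
    (x0 : X) (eps : R) (n0 : nat) : Prop :=
  [/\ (0 < n0)%N, dominated_from x0 eps n0 &
      forall m, (0 < m)%N -> dominated_from x0 eps m -> (n0 <= m)%N].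

(* Main.v *)
(* Write P and P^pi for the cohomological and homotopical Poincare polynomials.
   At t = eps the definition of the threshold gives P^pi_{X^r}(eps) < P_{X^r}(eps).
   The left side is r P^pi_X(eps), since pi_k(X^r) is the r-th power of pi_k(X).
   By Kunneth the right side is P_X(eps)^r, and P_X has constant term at most 1 and
   no linear term because X is simply connected.

   Only the inequality P_{X^r} <= P_X^r is needed, that is, that cross products
   span the cohomology of a product.  This uses half of the Eilenberg-Zilber
   theorem (the composite of the Alexander-Whitney map with a map back is
   homotopic to the identity of the cochains of the product, both the map back
   and the homotopy being built by acyclic models) and the bicomplex of
   functions of pairs of simplices, which is filtered by columns.  *)

Require Import Defs.
From mathcomp Require Import all_boot all_order all_algebra generic_quotient.
From mathcomp Require Import all_classical all_reals all_analysis.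
From mathcomp Require Import finmap ring lra zify.
Import numFieldNormedType.Exports.
Import Order.TTheory GRing.Theory Num.Theory.

Set Implicit Arguments.
Unset Strict Implicit.
Unset Printing Implicit Defensive.

Local Open Scope ring_scope.

(** * Cochains and bicomplexes *)

(** Chains are never formed: a chain is replaced by the evaluation of cochains on it, and naturality
    by pullback along words of vertices. Letting all maps of vertices act spares monotonicity
    conditions on words and provides reversed edges, which the argument in degree 1 uses.

    Dimensions and Poincare polynomials default to 0, so the two sides of the inequality call for
    different work. An upper bound on the cohomology of X^r survives the default, and spanning
    families give it: the induction on r multiplies a spanning family on X^r by a basis on X,
    independence entering on the factor X only. In homotopy the value r dim has to be attained, so a
    basis of pi_k(X^r) tensor Q is exhibited.

    For H^1 = 0, the triviality of pi_1 must become a relation between singular simplices: a null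
    homotopy of a loop, seen as a map on a square, is read along the edges of one singular
    5-simplex. *)

(* Simplicial sets on which all maps of vertices act, not only the monotone
   ones; singular simplices have this structure. *)
Record vset := Vset {
  vsimplex :> nat -> Type;
  act : forall m n, ('I_m.+1 -> 'I_n.+1) -> vsimplex n -> vsimplex m;
  act_id : forall n (s : vsimplex n), act id s = s;
  actA : forall l m n (u : 'I_l.+1 -> 'I_m.+1) (v : 'I_m.+1 -> 'I_n.+1)
    (s : vsimplex n), act u (act v s) = act (v \o u) s }.

Definition cob (A : vset) n (c : A n -> rat) : A n.+1 -> rat :=
  fun s => \sum_(i < n.+2) (-1) ^+ i * c (act (lift i) s).

(** The term (i, j) with i <= j cancels against the term (j + 1, i), the two signs differing by one
    factor -1. *)
Lemma alternating_double_sum0 m (F : nat -> nat -> rat) :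
  (forall i j, (i <= j < m)%N -> F i j = F j.+1 i) ->
  \sum_(i < m.+1) \sum_(j < m) (-1) ^+ i * ((-1) ^+ j * F i j) = 0.
Proof.
move=> HF; pose G i j := (-1) ^+ i * ((-1) ^+ j * F i j).
rewrite -[LHS]/(\sum_(i < m.+1) \sum_(j < m) G i j).
under eq_bigr => i _ do rewrite (bigID (fun j : 'I_m => (j < i)%N)) /=.
rewrite big_split /= big_ord_recl /= big_pred0 // add0r.
have -> : \sum_(i < m.+1) \sum_(j < m | ~~ (j < i)%N) G i j =
          \sum_(i < m) \sum_(j < m | ~~ (j < i)%N) G i j.
  rewrite big_ord_recr /= [X in _ + X]big_pred0 ?addr0 //.
  by move=> j; rewrite ltn_ord.
rewrite (exchange_big_dep xpredT) //= -big_split /= big1 // => i _.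
rewrite [X in X + _](_ : _ = - \sum_(j < m | ~~ (j < i)%N) G i j).
  by rewrite addNr.
rewrite -sumrN; apply: eq_big => [j|j /=]; first by rewrite /bump leq0n add1n ltnS leqNgt.
rewrite /bump leq0n add1n /G => ij; rewrite (HF i j); last by rewrite -ltnS ij ltn_ord.
by rewrite exprS mulN1r mulNr mulrCA.
Qed.

Lemma cob_cob (A : vset) n (c : A n -> rat) s : cob (cob c) s = 0.
Proof.
(* Faces are indexed by natural numbers, so that the simplicial identity becomes an identity of
   [bump]. *)
pose F i j := c (act (fun k : 'I_n.+1 => inord (bump i (bump j k))) s).
rewrite -[RHS](@alternating_double_sum0 n.+2 F).
  rewrite /cob; apply: eq_bigr => i _; rewrite mulr_sumr.
  apply: eq_bigr => j _; congr (_ * (_ * _)).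
  rewrite actA /F; congr (c (act _ s)); apply: funext => k /=.
  by apply: val_inj => /=; rewrite inordK // /bump; move: (ltn_ord k); lia.
move=> i j ij; rewrite /F; congr (c (act _ s)); apply: funext => k.
by congr inord; rewrite /bump; lia.
Qed.

(* The coboundary of a graded cochain; being 0 in degree 0, it spares case
   distinctions on the degree. *)
Definition gcob (A : vset) (c : forall p, A p -> rat) p : A p -> rat :=
  if p is p'.+1 then cob (c p') else fun=> 0.

Section Bicomplex.
Variables A B : vset.
Implicit Types c d : forall p q, A p -> B q -> rat.

Definition cobl c p q (a : A p) (b : B q) : rat :=
  gcob (fun p' (a' : A p') => c p' q a' b) a.

Definition cobr c p q (a : A p) (b : B q) : rat :=
  gcob (fun q' (b' : B q') => c p q' a b') b.

(** Indexed by the bidegree of the result; the sign (-1)^p makes the two partial coboundaries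
    anticommute. *)
Definition tcob c p q (a : A p) (b : B q) : rat :=
  cobl c a b + (-1) ^+ p * cobr c a b.

End Bicomplex.

Lemma cobD (A : vset) n (c d : A n -> rat) (k : rat) s :
  cob (fun a => c a + k * d a) s = cob c s + k * cob d s.
Proof.
rewrite /cob mulr_sumr -big_split /=; apply: eq_bigr => i _.
by rewrite mulrDr mulrCA.
Qed.

Lemma eq_gcob (A : vset) (c d : forall p, A p -> rat) p (a : A p) :
  (forall p' (a' : A p'), p = p'.+1 -> c p' a' = d p' a') -> gcob c a = gcob d a.
Proof.
case: p a => [|p] a H //=; apply: eq_bigr => i _; congr (_ * _).
exact: H.
Qed.

Lemma gcobD (A : vset) (c d : forall p, A p -> rat) (k : rat) p (a : A p) :
  gcob (fun p (a : A p) => c p a + k * d p a) a = gcob c a + k * gcob d a.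
Proof. by case: p a => [|p] a /=; rewrite ?cobD ?mulr0 ?addr0. Qed.

Lemma gcob0 (A : vset) p (a : A p) : gcob (fun p (a : A p) => 0) a = 0.
Proof. by case: p a => [|p] a //=; rewrite /cob big1 // => i _; rewrite mulr0. Qed.

Lemma gcobZ (A : vset) (d : forall p, A p -> rat) (k : rat) p (a : A p) :
  gcob (fun p (a : A p) => k * d p a) a = k * gcob d a.
Proof.
have := gcobD (fun p (_ : A p) => 0) d k a; rewrite gcob0 add0r => <-.
by apply: eq_gcob => p' a' _; rewrite add0r.
Qed.

Lemma gcob_sum (A : vset) (I : Type) (r : seq I) (P : pred I)
    (c : I -> forall p, A p -> rat) p (a : A p) :
  gcob (fun p (a : A p) => \sum_(i <- r | P i) c i p a) a =
  \sum_(i <- r | P i) gcob (c i) a.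
Proof.
case: p a => [|p] a /=; first by rewrite big1.
rewrite /cob exchange_big /=; apply: eq_bigr => i _.
by rewrite mulr_sumr.
Qed.

Lemma gcob_gcob (A : vset) (c : forall p, A p -> rat) p (a : A p) :
  gcob (gcob c) a = 0.
Proof.
case: p a => [|[|p]] a //=; last exact: cob_cob.
by rewrite /cob big1 // => i _; rewrite mulr0.
Qed.

Section BicomplexTheory.
Variables A B : vset.
Implicit Types c d : forall p q, A p -> B q -> rat.

(** Equalities known in a single total degree, such as those given by an induction, can be used
    under [tcob] in the next total degree. *)
Lemma eq_tcob c d p q (a : A p) (b : B q) :
  (forall p' q' (a' : A p') (b' : B q'), (p' + q').+1 = (p + q)%N ->
     c p' q' a' b' = d p' q' a' b') -> tcob c a b = tcob d a b.
Proof.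
move=> H; congr (_ + _ * _); apply: eq_gcob => i s E; apply: H; rewrite E.
  by rewrite addSn.
by rewrite addnS.
Qed.

Lemma tcobD c d (k : rat) p q (a : A p) (b : B q) :
  tcob (fun p q (a : A p) (b : B q) => c p q a b + k * d p q a b) a b =
  tcob c a b + k * tcob d a b.
Proof. by rewrite /tcob /cobl /cobr !gcobD; ring. Qed.

Lemma cobl_cobr c p q (a : A p) (b : B q) :
  cobl (cobr c) a b = cobr (cobl c) a b.
Proof.
rewrite /cobl /cobr; case: p q a b => [|p] [|q] a b //=.
- by rewrite /cob big1 // => i _; rewrite mulr0.
- by rewrite /cob big1 // => i _; rewrite mulr0.
rewrite /cob.
under eq_bigr do rewrite mulr_sumr.
rewrite exchange_big /=; apply: eq_bigr => i _; rewrite mulr_sumr.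
by apply: eq_bigr => j _; rewrite mulrCA.
Qed.

Lemma tcob_tcob c p q (a : A p) (b : B q) : tcob (tcob c) a b = 0.
Proof.
rewrite /tcob.
have -> : cobl (fun p q (a : A p) (b : B q) =>
    cobl c a b + (-1) ^+ p * cobr c a b) a b = - (-1) ^+ p * cobr (cobl c) a b.
  rewrite -cobl_cobr; case: p a => [|p] a; first by rewrite /cobl /= mulr0.
  rewrite [LHS]cobD.
  have -> : cob (fun a' => cobl c a' b) a = 0.
    exact: (gcob_gcob (fun p (a : A p) => c p q a b) (a : A p.+1)).
  by rewrite add0r exprS mulN1r opprK.
rewrite [X in _ + _ * X]gcobD.
have -> : gcob (fun q' (b' : B q') => cobr c a b') b = 0.
  exact: (gcob_gcob (fun q (b : B q) => c p q a b) b).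
by rewrite /cobr; ring.
Qed.

End BicomplexTheory.

(** * The Eilenberg-Zilber theorem by acyclic models *)

(* The model simplex, with the words on n + 1 letters as its simplices. *)
Definition words (n : nat) : vset.
Proof.
by refine (@Vset (fun k => 'I_k.+1 -> 'I_n.+1) (fun l m u w => w \o u) _ _).
Defined.

Definition prodv (A B : vset) : vset.
Proof.
refine (@Vset (fun n => (A n * B n)%type)
  (fun m n u s => (act u s.1, act u s.2)) _ _).
- by move=> n [a b] /=; rewrite !act_id.
- by move=> l m n u v [a b] /=; rewrite !actA.
Defined.

(** By the Yoneda lemma, a and b amount to a map from a product of two models to the product of A
    and B; cochains are pulled back along it. *)
Definition pullc (A B : vset) m n k (a : A m) (b : B n)
    (c : prodv A B k -> rat) : prodv (words m) (words n) k -> rat :=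
  fun w => c (act w.1 a, act w.2 b).

(* Prefixing the vertex 0 contracts the cochains of a product of two models, see
   conec_cob and conec_cob0. *)
Definition cone m k (u : words m k) : words m k.+1 :=
  fun i => oapp u ord0 (unlift ord0 i).

Definition conec m n k (c : prodv (words m) (words n) k.+1 -> rat) :
    prodv (words m) (words n) k -> rat :=
  fun w => c (cone w.1, cone w.2).

(* ezw n p q is meaningful for p + q = n; it is evaluation on a chain of
   dimension n in the product of the models of dimensions p and q, namely the
   cone on what the chain map condition prescribes for its boundary. *)
Fixpoint ezw n p q : (prodv (words p) (words q) n -> rat) -> rat :=
  match n with
  | 0 => fun c => c (fun=> ord0, fun=> ord0)
  | n'.+1 => fun c =>
      tcob (fun p' q' (u : words p p') (v : words q q') =>
        ezw (pullc u v (conec c))) (id : words p p) (id : words q q)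
  end.

(** Dual to a chain map from the tensor product of the chains of A and B to the chains of the
    product, extended from the models by naturality. *)
Definition ez (A B : vset) n (c : prodv A B n -> rat) p q (a : A p) (b : B q) :=
  ezw (pullc a b c).

Lemma ezwS n p q (c : prodv (words p) (words q) n.+1 -> rat) :
  ezw c = tcob (ez (conec c)) (id : words p p) (id : words q q).
Proof. by []. Qed.

Lemma cone_lift0 m k (u : words m k) : cone u \o lift ord0 = u.
Proof. by apply: funext => i; rewrite /cone /= liftK. Qed.

Lemma cone_liftS m k (u : words m k.+1) (i : 'I_k.+2) :
  cone u \o lift (lift ord0 i) = cone (u \o lift i).
Proof.
apply: funext => j; rewrite /cone /=; case: (unliftP ord0 j) => [j'|] -> /=.
  rewrite (_ : lift (lift ord0 i) (lift ord0 j') = lift ord0 (lift i j')).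
    by rewrite liftK.
  by apply: val_inj; rewrite /= /bump /=; lia.
rewrite (_ : lift (lift ord0 i) ord0 = ord0) ?unlift_none //.
by apply: val_inj.
Qed.

Section Naturality.
Variables A B : vset.

Lemma pullc_cob m n k (a : A m) (b : B n) (c : prodv A B k -> rat) :
  pullc a b (cob c) = cob (pullc a b c).
Proof.
apply: funext => w; rewrite /pullc /cob; apply: eq_bigr => i _.
by rewrite /= !actA.
Qed.

Lemma pullc_pullc m n m' n' k (a : A m) (b : B n) (u : words m m')
    (v : words n n') (c : prodv A B k -> rat) :
  pullc u v (pullc a b c) = pullc (act u a) (act v b) c.
Proof. by apply: funext => w; rewrite /pullc /= !actA. Qed.

Lemma ez_pullc m n k (a : A m) (b : B n) (c : prodv A B k -> rat) p q
    (u : words m p) (v : words n q) :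
  ez (pullc a b c) u v = ez c (act u a) (act v b).
Proof. by rewrite /ez pullc_pullc. Qed.

Lemma tcob_pull m n (a : A m) (b : B n) (c : forall p q, A p -> B q -> rat)
    p q (u : words m p) (v : words n q) :
  tcob (fun p q (u : words m p) (v : words n q) => c p q (act u a) (act v b))
    u v = tcob c (act u a) (act v b).
Proof.
rewrite /tcob; congr (_ + _ * _).
  case: p u => [|p] u //=; apply: eq_bigr => i _; by rewrite actA.
case: q v => [|q] v //=; apply: eq_bigr => i _; by rewrite actA.
Qed.

End Naturality.

(** Face 0 of a cone is its base, and face i + 1 is the cone on face i; this shift of the index
    produces the minus sign. *)
Lemma conec_cob m n k (c : prodv (words m) (words n) k.+1 -> rat) w :
  conec (cob c) w = c w - cob (conec c) w.
Proof.
rewrite /conec /cob big_ord_recl /= expr0 mul1r !cone_lift0 -sumrN.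
congr (c _ + _); first by case: w.
apply: eq_bigr => i _; rewrite !cone_liftS /bump leq0n add1n exprS.
by rewrite mulN1r mulNr.
Qed.

Lemma conec_cob0 m n (c : prodv (words m) (words n) 0 -> rat) w :
  conec (cob c) w = c w - c (fun=> ord0, fun=> ord0).
Proof.
have cone1 r (u : words r 0) : cone u \o lift (lift ord0 ord0) = fun=> ord0.
  apply: funext => j; rewrite /cone (ord1 j) /=.
  by rewrite (_ : lift (lift ord0 ord0) ord0 = ord0) ?unlift_none //; apply: val_inj.
rewrite /conec /cob !big_ord_recl big_ord0 addr0 /= !cone_lift0 !cone1.
by rewrite expr0 mul1r expr1 mulN1r; case: w.
Qed.

Lemma ezwD n p q (c d : prodv (words p) (words q) n -> rat) (k : rat) :
  ezw (fun w => c w + k * d w) = ezw c + k * ezw d.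
Proof.
elim: n p q c d => [|n IH] p q c d //=.
rewrite -tcobD; apply: eq_tcob => p' q' u v _; rewrite -IH.
by [].
Qed.

Lemma ezB (A B : vset) n (c d : prodv A B n -> rat) p q (a : A p) (b : B q) :
  ez (fun w => c w - d w) a b = ez c a b - ez d a b.
Proof.
rewrite /ez -[- ezw _]mulN1r -ezwD; congr ezw; apply: funext => w.
by rewrite mulN1r.
Qed.

(** By the contraction, [conec (cob c)] is c minus the coboundary of [conec c]. By induction [ez]
    turns that coboundary into a total coboundary, which the outer [tcob] kills. In the base case
    the correction is a constant, killed by [tcob] in total degree 1. *)
Lemma ezw_cob n p q (c : prodv (words p) (words q) n -> rat) :
  (p + q)%N = n.+1 ->
  ezw (cob c) = tcob (ez c) (id : words p p) (id : words q q).
Proof.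
elim: n p q c => [|n IH] p q c E; rewrite ezwS.
  rewrite (_ : conec _ = fun w => c w - c (fun=> ord0, fun=> ord0)); last first.
    by apply: funext => w; rewrite conec_cob0.
  by case: p q c E => [|[|p]] [|[|q]] //= c _;
    rewrite /tcob /cobl /cobr /= /cob !big_ord_recl !big_ord0 /ez /pullc /=; ring.
rewrite (_ : conec _ = fun w => c w - cob (conec c) w); last first.
  by apply: funext => w; rewrite conec_cob.
rewrite -[RHS]subr0 -(tcob_tcob (ez (conec c)) (id : words p p) (id : words q q)).
rewrite -[X in _ = _ - X]mul1r -mulNr -tcobD; apply: eq_tcob => p' q' u v E'.
rewrite ezB mulN1r; congr (_ - _); rewrite /ez pullc_cob IH; last by lia.
rewrite -[RHS](tcob_pull u v (ez (conec c)) id id).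
by apply: eq_tcob => p2 q2 u2 v2 _; rewrite -ez_pullc.
Qed.

Lemma ez_cob (A B : vset) n (c : prodv A B n -> rat) p q (a : A p) (b : B q) :
  (p + q)%N = n.+1 -> ez (cob c) a b = tcob (ez c) a b.
Proof.
move=> E; rewrite /ez pullc_cob ezw_cob // -{2}[a]act_id -{2}[b]act_id.
rewrite -(tcob_pull a b (ez c) id id).
by apply: eq_tcob => p2 q2 u2 v2 _; rewrite -ez_pullc.
Qed.

(** * The Alexander-Whitney map and the homotopy *)

Definition front n p : words n p := fun k => inord k.
Definition back n p q : words n q := fun k => inord (p + k).

(** The dual of the Alexander-Whitney map, from the bicomplex to the cochains of the product. *)
Definition aw (A B : vset) n (e : forall p q, A p -> B q -> rat)
    (s : prodv A B n) : rat :=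
  \sum_(p < n.+1) e p (n - p)%N (act (@front n p) s.1) (act (@back n p (n - p)) s.2).

Lemma front_face (A : vset) n p (i : nat) (a : A n.+1) (hi : (i < n.+2)%N) :
  (p < i)%N -> (p <= n)%N ->
  act (@front n p) (act (lift (Ordinal hi)) a) = act (@front n.+1 p) a.
Proof.
move=> pi pn; rewrite actA; congr (act _ a); apply: funext => k.
apply: val_inj => /=; rewrite !inordK /= /bump; move: (ltn_ord k); lia.
Qed.

Lemma front_faceS (A : vset) n p (i : nat) (a : A n.+1) (hi : (i < n.+2)%N)
    (hi' : (i < p.+2)%N) : (p <= n)%N ->
  act (@front n p) (act (lift (Ordinal hi)) a) =
  act (lift (Ordinal hi')) (act (@front n.+1 p.+1) a).
Proof.
move=> pn; rewrite !actA; congr (act _ a); apply: funext => k.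
apply: val_inj => /=; rewrite !inordK /= /bump; move: (ltn_ord k); lia.
Qed.

Lemma back_face (A : vset) n p q (i : nat) (a : A n.+1) (hi : (i < n.+2)%N) :
  (i <= p)%N -> (p + q = n)%N ->
  act (@back n p q) (act (lift (Ordinal hi)) a) = act (@back n.+1 p.+1 q) a.
Proof.
move=> pi pn; rewrite actA; congr (act _ a); apply: funext => k.
apply: val_inj => /=; rewrite !inordK /= /bump; move: (ltn_ord k); lia.
Qed.

Lemma back_faceS (A : vset) n p q (i : nat) (a : A n.+1) (hi : (p + i < n.+2)%N)
    (hi' : (i < q.+2)%N) : (p + q = n)%N ->
  act (@back n p q) (act (lift (Ordinal hi)) a) =
  act (lift (Ordinal hi')) (act (@back n.+1 p q.+1) a).
Proof.
move=> pn; rewrite !actA; congr (act _ a); apply: funext => k.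
apply: val_inj => /=; rewrite !inordK /= /bump; move: (ltn_ord k); lia.
Qed.

(** With [front_face_last], this identifies the two terms that cancel in [aw_tcob]: the last face of
    one front face and face 0 of one back face lead to the same pair of simplices. *)
Lemma back_face0 (A : vset) n p q (a : A n.+1) : (p + q = n)%N ->
  act (lift ord0) (act (@back n.+1 p q.+1) a) = act (@back n.+1 p.+1 q) a.
Proof.
move=> pn; rewrite !actA; congr (act _ a); apply: funext => k.
apply: val_inj => /=; rewrite !inordK /= /bump; move: (ltn_ord k); lia.
Qed.

Lemma front_face_last (A : vset) n p (a : A n.+1) : (p <= n)%N ->
  act (lift ord_max) (act (@front n.+1 p.+1) a) = act (@front n.+1 p) a.
Proof.
move=> pn; rewrite !actA; congr (act _ a); apply: funext => k.
apply: val_inj => /=; rewrite !inordK /= /bump; move: (ltn_ord k); lia.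
Qed.

Section AlexanderWhitney.
Variables A B : vset.
Implicit Types e : forall p q, A p -> B q -> rat.

Lemma cobr_eq0 e p q (a : A p) (b : B q) : q = 0 -> cobr e a b = 0.
Proof. by move=> q0; move: b; rewrite q0. Qed.

Lemma aw_tcob n e (s : prodv A B n.+1) : aw (tcob e) s = cob (aw (n := n) e) s.
Proof.
case: s => a b; rewrite /aw /cob /tcob big_split /=.
(* [cobl] vanishes for p = 0 and [cobr] for p = n + 1; after a shift both sums run over p <= n, like
   the right side once its sums are exchanged. *)
rewrite big_ord_recl [X in X + _ + _]/cobl /= add0r.
rewrite [X in _ + X]big_ord_recr /= [cobr e _ _ in X in _ + (_ + X)]cobr_eq0 ?subnn //.
rewrite mulr0 addr0.
under [RHS]eq_bigr do rewrite mulr_sumr.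
rewrite exchange_big /= -big_split /=; apply: eq_bigr => -[p /= pn] _.
rewrite -[X in X + _]/(cob (fun a' => e p (n - p)%N a'
  (act (@back n.+1 p.+1 (n - p)) b)) (act (@front n.+1 p.+1) a)).
have -> : (n.+1 - p = (n - p).+1)%N by rewrite subSn.
set q := (n - p)%N; have pq : (p + q = n)%N by rewrite /q; lia.
clearbody q.
have E : n.+2 = (p.+1 + q.+1)%N by lia.
rewrite /cobl /cobr /= /cob.
rewrite [X in X + _]big_ord_recr /= [X in _ + _ * X]big_ord_recl /= expr0 mul1r.
rewrite front_face_last // back_face0 // mulrDr.
(* The last face of the front part has sign (-1)^(p+1), face 0 of the back part has sign (-1)^p:
   they cancel. *)
rewrite [LHS](_ : _ = \sum_(i < p.+1) (-1) ^+ i * e p q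
     (act (lift (widen_ord (leqnSn p.+1) i)) (act (@front n.+1 p.+1) a))
     (act (@back n.+1 p.+1 q) b) + (-1) ^+ p *
   (\sum_(i < q.+1) (-1) ^+ bump 0 i * e p q
      (act (@front n.+1 p) a)
      (act (lift (lift ord0 i)) (act (@back n.+1 p q.+1) b)))); last first.
  by rewrite exprS; ring.
(* In natural number indices, the n + 2 faces can be split into the first p + 1, acting on the
   front, and the others, acting on the back. *)
pose F (i : nat) := (-1) ^+ i * e p q
   (act (@front n p) (act (lift (inord i : 'I_n.+2)) a))
   (act (@back n p q) (act (lift (inord i : 'I_n.+2)) b)).
rewrite [RHS](eq_bigr (fun i : 'I_n.+2 => F i)); last first.
  by move=> i _; rewrite /F inord_val.
rewrite -[RHS](big_mkord xpredT F) E big_mkord big_split_ord /=.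
congr (_ + _).
  apply: eq_bigr => -[i ip] _ /=; rewrite /F.
  have hi : (i < n.+2)%N by lia.
  rewrite (_ : inord i = Ordinal hi); last by apply: val_inj; rewrite /= inordK.
  have hi' : (i < p.+2)%N by lia.
  rewrite (_ : widen_ord _ _ = Ordinal hi'); last exact: val_inj.
  by rewrite (front_faceS _ _ hi') // back_face.
rewrite mulr_sumr; apply: eq_bigr => -[i iq] _ /=; rewrite /F.
have hi : (p + i.+1 < n.+2)%N by lia.
rewrite (_ : inord (p.+1 + i) = Ordinal hi); last first.
  by apply: val_inj; rewrite /= inordK addSnnS.
have hi' : (i.+1 < q.+2)%N by lia.
rewrite front_face //; [|lia].
rewrite (_ : lift ord0 _ = Ordinal hi'); last exact: val_inj.
by rewrite (back_faceS _ _ hi') // mulrA -exprD /bump leq0n add1n addSnnS.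
Qed.

Lemma aw_pull m n (a : A m) (b : B n) e k (u : words m k) (v : words n k) :
  aw (fun p q (u : words m p) (v : words n q) => e p q (act u a) (act v b))
    ((u, v) : prodv (words m) (words n) k) =
  aw e ((act u a, act v b) : prodv A B k).
Proof. by apply: eq_bigr => p _; rewrite /= !actA. Qed.

Lemma eq_aw e e' n (s : prodv A B n) :
  (forall p q (a : A p) (b : B q), (p + q = n)%N -> e p q a b = e' p q a b) ->
  aw e s = aw e' s.
Proof.
by move=> H; apply: eq_bigr => -[p pn] _; apply: H; rewrite /= subnKC.
Qed.

Lemma awD e e' (k : rat) n (s : prodv A B n) :
  aw (fun p q a b => e p q a b + k * e' p q a b) s = aw e s + k * aw e' s.
Proof. by rewrite /aw big_split mulr_sumr. Qed.

End AlexanderWhitney.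

(* Evaluation on the chain that defines the homotopy on the diagonal simplex of
   the product of two models: again a cone on its prescribed boundary. *)
Fixpoint htpw n : (prodv (words n) (words n) n.+1 -> rat) -> rat :=
  match n with
  | 0 => fun=> 0
  | n'.+1 => fun c =>
      let d := conec c in
      aw (ez d) ((id, id) : prodv (words n'.+1) (words n'.+1) n'.+1)
      - d (id, id)
      - cob (fun w : prodv (words n'.+1) (words n'.+1) n' =>
               htpw (pullc w.1 w.2 d)) (id, id)
  end.

Definition htp (A B : vset) n (c : prodv A B n.+1 -> rat) : prodv A B n -> rat :=
  fun s => htpw (pullc s.1 s.2 c).

Definition cob_htp (A B : vset) n : (prodv A B n -> rat) -> prodv A B n -> rat :=
  match n with 0 => fun _ _ => 0 | n'.+1 => fun c => cob (htp c) end.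

Lemma htpwB n (c d : prodv (words n) (words n) n.+1 -> rat) :
  htpw (fun w => c w - d w) = htpw c - htpw d.
Proof.
elim: n c d => [|n IH] c d; first by rewrite /= subr0.
rewrite /= -[conec _]/(fun w => conec c w - conec d w).
rewrite (@eq_aw _ _ _ (fun p q a b => ez (conec c) a b + -1 * ez (conec d) a b));
  last by move=> p q a b _; rewrite ezB mulN1r.
rewrite awD.
have -> : (fun w : prodv (words n.+1) (words n.+1) n =>
    htpw (pullc w.1 w.2 (fun w => conec c w - conec d w))) =
    (fun w => htpw (pullc w.1 w.2 (conec c)) + -1 * htpw (pullc w.1 w.2 (conec d))).
  by apply: funext => w; rewrite -[pullc _ _ _]/(fun w' => pullc w.1 w.2 (conec c) w' -
    pullc w.1 w.2 (conec d) w') IH mulN1r.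
rewrite cobD; ring.
Qed.

Lemma htp_pullc (A B : vset) n m (a : A m) (b : B m) (c : prodv A B n.+1 -> rat)
    (w : prodv (words m) (words m) n) :
  htp (pullc a b c) w = htp c (act w.1 a, act w.2 b).
Proof. by rewrite /htp pullc_pullc. Qed.

(** Thus [aw] after [ez] is homotopic to the identity. As in [ezw_cob], [conec (cob d)] is d minus a
    coboundary; [aw] and [ez] commute with coboundaries, and the induction hypothesis leaves only
    terms that cancel or are coboundaries of coboundaries. *)
Lemma htp_cob (A B : vset) n (c : prodv A B n -> rat) (s : prodv A B n) :
  htp (cob c) s = aw (ez c) s - c s - cob_htp c s.
Proof.
elim: n A B c s => [|n IH] A B c [a b].
  have w1 (u : words 0 0) : u = id by apply: funext => i; rewrite !ord1.
  rewrite /htp /= subr0 /aw big_ord_recl big_ord0 addr0 /ez /= /pullc /=.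
  rewrite (w1 (fun=> ord0)) (w1 (@front 0 0)) (w1 (@back 0 0 0)) !act_id.
  by rewrite subrr.
(* The universal case, on the diagonal simplex of a product of two models; the general case is
   pulled back from it. *)
have {}IHw (d : prodv (words n.+1) (words n.+1) n.+1 -> rat) :
  htpw (cob d) = aw (ez d) ((id, id) : prodv (words n.+1) (words n.+1) n.+1)
    - d (id, id) - cob (htp d) (id, id).
  rewrite /= (_ : conec _ = fun w => d w - cob (conec d) w); last first.
    by apply: funext => w; rewrite conec_cob.
  rewrite (@eq_aw _ _ _ (fun p q a b => ez d a b + -1 * tcob (ez (conec d)) a b));
    last by move=> p q u v E; rewrite ezB ez_cob // mulN1r.
  rewrite awD aw_tcob.
  have -> : (fun w : prodv (words n.+1) (words n.+1) n =>
      htpw (pullc w.1 w.2 (fun w => d w - cob (conec d) w))) =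
      (fun w => htp d w + -1 * (aw (ez (conec d)) w + -1 * (conec d w + 1 * cob_htp (conec d) w))).
    apply: funext => w; rewrite -[pullc _ _ _]/(fun w' => pullc w.1 w.2 d w' -
      pullc w.1 w.2 (cob (conec d)) w') htpwB -/(htp _ _) -[X in _ - X]/(htp _ _).
    rewrite IH; ring.
  rewrite !cobD.
  have -> : cob (cob_htp (conec d)) (id, id) = 0.
    case: {IH} (n) d => [|n'] d /=; last exact: cob_cob.
    by rewrite /cob big1 // => i _; rewrite mulr0.
  ring.
rewrite [LHS]/htp pullc_cob IHw.
have <- : aw (ez (pullc a b c)) ((id, id) : prodv (words n.+1) (words n.+1) n.+1) =
    aw (ez c) (a, b).
  have := aw_pull a b (ez c) id id; rewrite !act_id => <-.
  by apply: eq_aw => p q u v _; rewrite ez_pullc.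
congr (_ - _ - _); first by rewrite /pullc /= !act_id.
by rewrite /cob; apply: eq_bigr => i _; rewrite htp_pullc.
Qed.

(** * Cross products span the cohomology of a product *)

Section Extend.
Variables (T : nat -> Type) (V : Type) (v0 : V).

(* The graded family equal to f in degree m and to the junk value v0 elsewhere. *)
Definition extend m (f : T m -> V) p : T p -> V :=
  match @eqP nat m p with
  | ReflectT e => eq_rect m (fun p => T p -> V) f p e
  | ReflectF _ => fun=> v0
  end.

Lemma extend_same m (f : T m -> V) x : extend f x = f x.
Proof. by rewrite /extend; case: eqP => // e; rewrite (eq_axiomK e). Qed.

Lemma extend_neq m (f : T m -> V) p (x : T p) : m <> p -> extend f x = v0.
Proof. by rewrite /extend; case: eqP. Qed.

End Extend.

Definition cocycle (A : vset) n (c : A n -> rat) := forall s, cob c s = 0.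

Lemma cocycleZ (A : vset) n (c : A n -> rat) k :
  cocycle c -> cocycle (fun a => k * c a).
Proof.
move=> Zc s; rewrite -[RHS](mulr0 k) -[X in k * X](Zc s) [in RHS]/cob mulr_sumr.
by apply: eq_bigr => i _; rewrite mulrCA.
Qed.

Lemma cocycle_sum (A : vset) n (K : finType) (c : K -> A n -> rat) :
  (forall k, cocycle (c k)) -> cocycle (fun a => \sum_k c k a).
Proof.
move=> Zc s; rewrite /cob; under eq_bigr do rewrite mulr_sumr.
by rewrite exchange_big big1 //= => k _; apply: Zc.
Qed.

Lemma gcob_cocycle (A : vset) (c : forall p, A p -> rat) p (a : A p) :
  (forall p, cocycle (c p)) -> gcob c a = 0.
Proof. by move=> Zc; case: p a => [|p] a //; apply: Zc. Qed.

(** The classes span the cohomology. Coboundaries are written [gcob y], which covers degree 0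
    uniformly, and [#|I n|] then bounds the dimension in degree n. *)
Definition spanning (A : vset) (I : nat -> finType)
    (al : forall n, I n -> A n -> rat) :=
  (forall n i, cocycle (al n i)) /\
  forall n (c : A n -> rat), cocycle c -> exists (l : I n -> rat) y,
    forall s, c s = \sum_i l i * al n i s + gcob y s.

Definition independent (A : vset) (I : nat -> finType)
    (al : forall n, I n -> A n -> rat) :=
  forall n (l : I n -> rat) y,
    (forall s, \sum_i l i * al n i s = gcob y s) -> forall i, l i = 0.

Lemma gcob_extend (A : vset) n (c : A n -> rat) p (a : A p) :
  cocycle c -> gcob (fun p (a : A p) => extend (T := A) 0 c a) a = 0.
Proof.
case: p a => [//|p] a Zc /=; have [E|E] := eqVneq n p.
  by case: p / E a => a; rewrite -[RHS](Zc a); apply: eq_bigr => i _; rewrite extend_same.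
by rewrite /cob big1 // => i _; rewrite extend_neq ?mulr0 //; apply/eqP.
Qed.

Section Kunneth.
Variables (A B : vset) (I J : nat -> finType).
Variables (al : forall n, I n -> A n -> rat) (be : forall n, J n -> B n -> rat).
Hypotheses (al_span : spanning al) (be_span : spanning be).
Hypothesis be_indep : independent be.
Implicit Types (c y : forall p q, A p -> B q -> rat).
Implicit Types l : forall p q, I p -> J q -> rat.

Definition comb l p q (a : A p) (b : B q) : rat :=
  \sum_i \sum_j l p q i j * (al i a * be j b).

Lemma tcob_comb l p q (a : A p) (b : B q) : tcob (comb l) a b = 0.
Proof.
have [Za _] := al_span; have [Zb _] := be_span.
rewrite /tcob /cobl /cobr /comb !gcob_cocycle ?mulr0 ?addr0 // => r;
  apply: cocycle_sum => i; apply: cocycle_sum => j; apply: cocycleZ.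
  exact: cocycleZ.
by under eq_fun do rewrite mulrC; apply: cocycleZ.
Qed.

(* In a cocycle whose columns before the m-th vanish, the m-th column takes its
   values in cocycles of B.  Their coordinates on be are cocycles of A: by the
   next column, the combination of be with the coboundaries of the coordinates
   as coefficients is exact, and be is independent. *)
Lemma kunneth_column m q c :
  (forall p' q' (a : A p') (b : B q'), (p' + q' = (m + q).+1)%N ->
    tcob c a b = 0) ->
  (forall p' q' (a : A p') (b : B q'), (p' + q' = m + q)%N -> (p' < m)%N ->
    c p' q' a b = 0) ->
  exists l y, forall p' q' (a : A p') (b : B q'), (p' + q' = m + q)%N ->
    (p' <= m)%N -> c p' q' a b = comb l a b + tcob y a b.
Proof.
move=> Zc c0; have [Za Sa] := al_span; have [Zb Sb] := be_span.
(* In bidegree (m, q + 1) the left part of the cocycle equation involves column m - 1 only and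
   vanishes; what remains is the coboundary in B for fixed a. *)
have /choice[uy uyP] : forall a : A m, exists uy : (J q -> rat) * (forall q, B q -> rat),
    forall b, c m q a b = \sum_j uy.1 j * be j b + gcob uy.2 b.
  move=> a; have /Sb[u [y uyP]] : cocycle (c m q a).
    move=> b; have := Zc m q.+1 a b; rewrite addnS => /(_ erefl).
    rewrite /tcob (_ : cobl c a b = 0) ?add0r.
      by move/eqP; rewrite mulf_eq0 signr_eq0 => /eqP.
    rewrite /cobl; case: (m) a c0 => [//|m'] a c0 /=.
    by rewrite /cob big1 // => i _; rewrite c0 ?mulr0 // addSnnS.
  by exists (u, y).
pose u a := (uy a).1; pose y a := (uy a).2.
have {}uyP a b : c m q a b = \sum_j u a j * be j b + gcob (y a) b by exact: uyP.
have Zu j : cocycle (fun a => u a j).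
  (* The primitive collects the remainders [y] on the faces of a and the column m + 1, as they occur
     in the cocycle equation in bidegree (m + 1, q). *)
  move=> a; move: j; apply: (be_indep (n := q) (l := fun j => cob (fun a => u a j) a)
    (y := fun q b => - (\sum_(i < m.+2) (-1) ^+ i * y (act (lift i) a) q b)
                     + (-1) ^+ m * c m.+1 q a b)).
  move=> b; have := Zc m.+1 q a b; rewrite addSn => /(_ erefl).
  rewrite gcobD.
  have -> : gcob (fun q b => - (\sum_(i < m.+2) (-1) ^+ i * y (act (lift i) a) q b)) b
     = - (\sum_(i < m.+2) (-1) ^+ i * gcob (y (act (lift i) a)) b).
    transitivity (gcob (fun q b => -1 *
        \sum_(i < m.+2) (-1) ^+ i * y (act (lift i) a) q b) b).
      by apply: eq_gcob => q' b' _; rewrite mulN1r.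
    rewrite gcobZ gcob_sum mulN1r; congr (- _).
    by apply: eq_bigr => i _; rewrite gcobZ.
  rewrite /tcob exprS mulN1r mulNr => /eqP; rewrite subr_eq0 => /eqP E.
  rewrite [X in _ = _ + X](_ : _ = cobl c a b); last by rewrite E.
  rewrite /cobl /= /cob -sumrN.
  under [X in _ = _ + X]eq_bigr do rewrite uyP mulrDr.
  rewrite big_split /= sumrN addrCA addNr addr0.
  under eq_bigr do rewrite mulr_suml.
  rewrite exchange_big /=; apply: eq_bigr => i _; rewrite mulr_sumr.
  by apply: eq_bigr => j _; rewrite mulrA.
have /choice[lw lwP] : forall j : J q, exists lw : (I m -> rat) * (forall p, A p -> rat),
    forall a, u a j = \sum_i lw.1 i * al i a + gcob lw.2 a.
  by move=> j; have [l [w lwP]] := Sa _ _ (Zu j); exists (l, w).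
pose w j := (lw j).2.
exists (fun p' q' i j =>
  extend (T := I) 0 (fun i => extend (T := J) 0 (fun j => (lw j).1 i) j) i).
(* [Y1] lives in row q and reduces the coordinates to combinations of [al]; it has no [cobr] since
   the [be j] are cocycles. [Y2] lives in column m and yields the remainders [y a]; its factor
   (-1)^m below cancels the sign in [tcob]. *)
pose Y1 p' q' (a : A p') (b : B q') : rat :=
  extend (T := B) 0 (fun b => \sum_j w j p' a * be j b) b.
pose Y2 p' q' (a : A p') (b : B q') : rat :=
  extend (T := A) (fun q' (b : B q') => 0) y a q' b.
exists (fun p' q' a b => Y1 p' q' a b + (-1) ^+ m * Y2 p' q' a b).
have Y1r p' q' (a : A p') (b : B q') : cobr Y1 a b = 0.
  by apply: gcob_extend; apply: cocycle_sum => j; apply: cocycleZ.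
have Y2l p' q' (a : A p') (b : B q') : (p' <= m)%N -> cobl Y2 a b = 0.
  move=> p'm; rewrite -(gcob0 a); apply: eq_gcob => p2 a2 E.
  by rewrite /Y2 extend_neq //; lia.
move=> p' q' a b E p'm; rewrite tcobD {1 2}/tcob Y1r Y2l // mulr0 addr0 add0r.
have [pm|pm] := eqVneq p' m; last first.
  rewrite c0 //; last by lia.
  rewrite /comb big1 ?add0r; last first.
    by move=> i _; rewrite big1 // => j _; rewrite extend_neq ?mul0r //; lia.
  rewrite (_ : cobl _ a b = 0) ?add0r; last first.
    by rewrite -(gcob0 a); apply: eq_gcob => p2 a2 _; rewrite /Y1 extend_neq //; lia.
  rewrite (_ : cobr _ a b = 0) ?mulr0 //.
  by rewrite -(gcob0 b); apply: eq_gcob => p2 a2 _; rewrite /Y2 extend_neq //; lia.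
subst p'; have {E}E : q' = q by lia.
subst q'; rewrite mulrA -expr2 sqrr_sign mul1r addrA uyP; congr (_ + _); last first.
  by apply: eq_gcob => q2 b2 _; rewrite /Y2 extend_same.
have -> : cobl Y1 a b = \sum_j gcob (w j) a * be j b.
  transitivity (gcob (fun p (a : A p) => \sum_j be j b * w j p a) a).
    apply: eq_gcob => p2 a2 _; rewrite /Y1 extend_same.
    by apply: eq_bigr => j _; rewrite mulrC.
  by rewrite gcob_sum; apply: eq_bigr => j _; rewrite gcobZ mulrC.
rewrite /comb exchange_big -big_split /=; apply: eq_bigr => j _.
rewrite lwP mulrDl mulr_suml; congr (_ + _); apply: eq_bigr => i _.
by rewrite !extend_same mulrA.
Qed.

(** Columns are cleared one at a time: subtracting the solution for the first k columns leaves a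
    total cocycle to which [kunneth_column] applies. *)
Lemma kunneth_bicomplex n c :
  (forall p q (a : A p) (b : B q), (p + q = n.+1)%N -> tcob c a b = 0) ->
  exists l y, forall p q (a : A p) (b : B q), (p + q = n)%N ->
    c p q a b = comb l a b + tcob y a b.
Proof.
move=> Zc.
suff H k : (k <= n.+1)%N -> exists l y, forall p q (a : A p) (b : B q),
    (p + q = n)%N -> (p < k)%N -> c p q a b = comb l a b + tcob y a b.
  have [l [y H']] := H _ (leqnn _); exists l, y => p q a b E; apply: H' => //; lia.
elim: k => [|k IH] kn; first by exists (fun _ _ _ _ => 0), (fun _ _ _ _ => 0).
have [l [y ly]] := IH (ltnW kn).
pose c' p q (a : A p) (b : B q) :=
  (c p q a b + -1 * comb l a b) + -1 * tcob y a b.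
have kq : (k + (n - k) = n)%N by lia.
have [||l' [y' ly']] := @kunneth_column k (n - k)%N c'.
- move=> p q a b; rewrite kq => E.
  by rewrite /c' !tcobD tcob_comb tcob_tcob Zc // !mulr0 !addr0.
- move=> p q a b; rewrite kq => E pk.
  by rewrite /c' ly //; ring.
exists (fun p q i j => l p q i j + l' p q i j).
exists (fun p q a b => y p q a b + 1 * y' p q a b) => p q a b E pk.
have := ly' p q a b; rewrite kq => /(_ E pk); rewrite /c' tcobD => Ec.
have -> : comb (fun p q i j => l p q i j + l' p q i j) a b = comb l a b + comb l' a b.
  rewrite /comb -big_split; apply: eq_bigr => i _; rewrite -big_split.
  by apply: eq_bigr => j _; rewrite mulrDl.
have -> : c p q a b = c p q a b + -1 * comb l a b + -1 * tcob y a b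
   + comb l a b + tcob y a b by ring.
by rewrite Ec; ring.
Qed.

Definition cross n (k : {p : 'I_n.+1 & (I p * J (n - p)%N)%type}) :
    prodv A B n -> rat :=
  fun s => al (tagged k).1 (act (@front n (tag k)) s.1) *
           be (tagged k).2 (act (@back n (tag k) (n - tag k)) s.2).

Lemma aw_comb l n (s : prodv A B n) :
  aw (comb l) s =
  \sum_k l (tag k : 'I__) (n - tag k)%N (tagged k).1 (tagged k).2 * cross k s.
Proof.
rewrite /aw /comb.
under eq_bigr do rewrite pair_big /=.
by rewrite (sig_big_dep _ _ (fun (p : 'I_n.+1) k => l p (n - p)%N k.1 k.2 *
   (al k.1 (act (@front n p) s.1) * be k.2 (act (@back n p (n - p)) s.2)))).
Qed.

Lemma cross_cocycle n k : cocycle (@cross n k).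
Proof.
have [Za _] := al_span; have [Zb _] := be_span.
move=> s; case: k => -[p pn] /= [i j].
(* A cross product is the image under [aw] of a function concentrated in one bidegree, so [aw_tcob]
   applies. *)
have -> : cross (existT _ (Ordinal pn) (i, j)) = aw (fun p q (a : A p) (b : B q) =>
    extend (T := A) 0 (al i) a * extend (T := B) 0 (be j) b) (n := n).
  apply: funext => t; rewrite /aw (bigD1 (Ordinal pn)) //= big1 ?addr0.
    by rewrite !extend_same.
  move=> p' p'p; rewrite extend_neq ?mul0r // => E; move/eqP: p'p; apply.
  exact: val_inj.
rewrite -aw_tcob /aw big1 // => q _; rewrite /tcob /cobl /cobr gcobZ gcob_extend //.
rewrite !mulr0 addr0.
have -> : gcob (fun p' (a : A p') => extend (T := A) 0 (al i) a *
   extend (T := B) 0 (be j) (act (@back n.+1 q (n.+1 - q)) s.2))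
   (act (@front n.+1 q) s.1) = extend (T := B) 0 (be j) (act (@back n.+1 q (n.+1 - q)) s.2)
     * gcob (fun p' (a : A p') => extend (T := A) 0 (al i) a) (act (@front n.+1 q) s.1).
  by rewrite -gcobZ; apply: eq_gcob => p' a _; rewrite mulrC.
by rewrite gcob_extend ?mulr0.
Qed.

(** The total cocycle [ez c] is [comb l] plus [tcob y]. Applying [aw] and the homotopy recovers c:
    [aw (comb l)] is a combination of cross products, and the other terms are coboundaries, [aw]
    commuting with coboundaries. *)
Lemma kunneth_spanning : spanning cross.
Proof.
split=> [|n c Zc]; first exact: cross_cocycle.
have [|l [y ly]] := @kunneth_bicomplex n (ez c).
  move=> p q a b E; rewrite -ez_cob //.
  (* The zero cochain written as a difference, for [ezB] to apply. *)
  have -> : cob c = (fun w => cob c w - cob c w).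
    by apply: funext => w; rewrite Zc subr0.
  by rewrite ezB subrr.
exists (fun k => l (tag k : 'I__) (n - tag k)%N (tagged k).1 (tagged k).2).
have Ec s : c s = aw (comb l) s + aw (tcob y) s - cob_htp c s.
  have H0 : htp (cob c) s = 0.
    have -> : cob c = (fun w => cob c w - cob c w).
      by apply: funext => w; rewrite Zc subr0.
    by rewrite /htp htpwB subrr.
  have := htp_cob c s; rewrite H0 (@eq_aw _ _ _ (fun p q a b =>
    comb l a b + 1 * tcob y a b)); last by move=> p q a b E; rewrite mul1r ly.
  by rewrite awD => /esym/eqP; rewrite -addrA -opprD subr_eq0 mul1r => /eqP ->; rewrite addrK.
case: n c Zc l y ly Ec => [|n] c Zc l y ly Ec.
  exists (fun _ _ => 0) => s; rewrite Ec aw_comb /= subr0; congr (_ + _).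
  by rewrite /aw big1 // => -[[|//] ?] _; rewrite /tcob /cobl /cobr mulr0 addr0.
exists (fun p s => aw y s + -1 * extend (T := prodv A B) 0 (htp c) s) => s.
rewrite Ec aw_comb gcobD mulN1r addrA aw_tcob; congr (_ - _).
by apply: eq_bigr => i _; rewrite extend_same.
Qed.

End Kunneth.

(** * Iterated cross products *)

Lemma spanning_iso (A B : vset) (I : nat -> finType)
    (al : forall n, I n -> B n -> rat) (f : forall n, A n -> B n)
    (g : forall n, B n -> A n) :
  (forall n, cancel (@f n) (@g n)) -> (forall n, cancel (@g n) (@f n)) ->
  (forall m n (u : 'I_m.+1 -> 'I_n.+1) s, f _ (act u s) = act u (f _ s)) ->
  spanning al -> spanning (fun n i s => al n i (f n s)).
Proof.
move=> fK gK fact [Z S].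
have gact m n (u : 'I_m.+1 -> 'I_n.+1) s : g _ (act u s) = act u (g _ s).
  by rewrite -[RHS]fK fact gK.
split=> [n i s|n c Zc].
  by rewrite -[RHS](Z n i (f _ s)); apply: eq_bigr => k _; rewrite fact.
have [|l [y ly]] := S n (fun s => c (g _ s)).
  by move=> s; rewrite -[RHS](Zc (g _ s)); apply: eq_bigr => k _; rewrite gact.
exists l, (fun p s => y p (f p s)) => s; rewrite -{1}[s]fK ly; congr (_ + _).
by case: n s {c Zc l ly} => [|n] s //; apply: eq_bigr => i _; rewrite fact.
Qed.

Definition powv (A : vset) (r : nat) : vset.
Proof.
refine (@Vset (fun n => 'I_r -> A n) (fun m n u s => fun i => act u (s i)) _ _).
- by move=> n s; apply: funext => i; rewrite act_id.
- by move=> l m n u v s; apply: funext => i; rewrite actA.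
Defined.

(** The r-fold cross products of degree n: the recursion is that of the coefficients of an r-th
    power, starting with the cohomology of a point. *)
Fixpoint pow_index (J : nat -> finType) (r n : nat) : finType :=
  match r with
  | 0 => 'I_(n == 0%N)
  | r'.+1 => {p : 'I_n.+1 & (pow_index J r' p * J (n - p)%N)%type}
  end.

Lemma sum_signs m : \sum_(i < m) (-1) ^+ i = (odd m)%:R :> rat.
Proof.
elim: m => [|m IH]; first by rewrite big_ord0.
by rewrite big_ord_recr IH -signr_odd /=; case: (odd m); rewrite ?expr1 ?addrN.
Qed.

Lemma spanning_pow (A : vset) (J : nat -> finType)
    (be : forall n, J n -> A n -> rat) (r : nat) :
  spanning be -> independent be ->
  exists al : forall n, pow_index J r n -> powv A r n -> rat, spanning al.
Proof.
move=> sp ind; elim: r => [|r [al IH]].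
  have p0 n (s t : powv A 0 n) : s = t by apply: funext => -[].
  have pt n : powv A 0 n by case.
  (* The power of exponent 0 has one simplex in each degree, so [cob] from degree n is 0 or the
     identity according to the parity of n. *)
  have cobE n (c : powv A 0 n -> rat) s t : cob c s = (odd n)%:R * c t.
    have := sum_signs n.+2; rewrite /= negbK => <-.
    by rewrite mulr_suml; apply: eq_bigr => i _; congr (_ * c _); apply: p0.
  exists (fun n _ _ => 1); split=> [n i s|n c Zc].
    by rewrite (cobE _ _ s (pt n)) mulr1; case: n i {s} => [|n] /= [].
  have {}Zc : (odd n)%:R * c (pt n) = 0 by rewrite -(cobE _ _ (pt n.+1)).
  case: n c Zc => [|n] c Zc.
    exists (fun=> c (pt 0)), (fun _ _ => 0) => s.
    by rewrite sumr_const card_ord /= addr0 mulr1 (p0 _ s (pt 0)).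
  (* For odd n the constant c is its own primitive; for even n the cocycle condition makes it 0. *)
  exists (fun=> 0), (fun _ _ => c (pt n.+1)) => s.
  rewrite big1 ?add0r => [|i _]; last by rewrite mul0r.
  rewrite /= (cobE _ _ _ (pt n)) (p0 _ s (pt n.+1)); move: Zc => /=.
  by case: (odd n); rewrite /= ?mul1r ?mul0r.
(* Coordinate 0 is split off as the right factor, where the Kunneth argument uses the independence
   of [be]. *)
pose f n (s : powv A r.+1 n) : prodv (powv A r) A n :=
  (fun i => s (lift ord0 i), s ord0).
pose g n (s : prodv (powv A r) A n) : powv A r.+1 n :=
  fun i => oapp s.1 s.2 (unlift ord0 i).
have fK n : cancel (f n) (g n).
  move=> s; apply: funext => i; rewrite /g /f /=.
  by case: unliftP => [j|] ->.
have gK n : cancel (g n) (f n).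
  move=> [s t]; rewrite /g /f /=; congr (_, _); last by rewrite unlift_none.
  by apply: funext => i; rewrite liftK.
exists (fun n (i : {p : 'I_n.+1 & (pow_index J r p * J (n - p)%N)%type}) s =>
  cross al be i (f n s)).
have fact m n (u : 'I_m.+1 -> 'I_n.+1) s : f _ (act u s) = act u (f _ s) by [].
exact: (spanning_iso fK gK fact (kunneth_spanning IH sp ind)).
Qed.

Lemma card_pow_index (R : comNzRingType) (J : nat -> finType) (P : {poly R}) r n :
  (forall n, P`_n = #|J n|%:R) -> #|pow_index J r n|%:R = (P ^+ r)`_n.
Proof.
move=> PJ; elim: r n => [|r IH] n.
  by rewrite /= card_ord expr0 coef1.
rewrite /= card_tagged exprSr coefM sumnE big_map natr_sum big_enum /=.
by apply: eq_bigr => i _; rewrite card_prod natrM IH PJ.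
Qed.

(** * Singular cohomology of powers *)

Section SingularVset.
Variables (R : realType) (X : topologicalType).

Lemma vertex_map_subproof m n (u : 'I_m.+1 -> 'I_n.+1) (x : simplex R m) :
  \row_j (\sum_(i | u i == j) \val x ord0 i) \in simplex R n.
Proof.
have [x_ge0 x_sum] := set_mem (valP x); apply/mem_set; split=> [j|].
  by rewrite mxE sumr_ge0.
rewrite -[RHS]x_sum (partition_big u xpredT) //=.
by apply: eq_bigr => j _; rewrite mxE.
Qed.

Definition vertex_map m n (u : 'I_m.+1 -> 'I_n.+1) (x : simplex R m) :
    simplex R n :=
  exist (fun y => y \in simplex R n) _ (vertex_map_subproof u x).

Lemma vertex_map_continuous m n (u : 'I_m.+1 -> 'I_n.+1) :
  continuous (vertex_map u).
Proof.
apply: continuous_set_type; apply: continuous_rV => j /=.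
under eq_fun do rewrite mxE.
apply: continuous_big => [|i _]; first exact: add_continuous.
exact: continuous_coord.
Qed.

Lemma vertex_map_id n (x : simplex R n) : vertex_map id x = x.
Proof.
apply: val_inj; apply/matrixP => i j; rewrite (ord1 i) mxE.
by rewrite (big_pred1 j).
Qed.

Lemma vertex_map_comp l m n (u : 'I_l.+1 -> 'I_m.+1) (v : 'I_m.+1 -> 'I_n.+1) x :
  vertex_map v (vertex_map u x) = vertex_map (v \o u) x.
Proof.
apply: val_inj; apply/matrixP => i j; rewrite !mxE.
rewrite [RHS](partition_big u (fun k => v k == j)) //=.
apply: eq_bigr => k vk; rewrite mxE; apply: eq_bigl => i'.
by apply/idP/idP => [/eqP E|/andP[_ ->]//]; rewrite E vk eqxx.
Qed.

Lemma vertex_map_lift n (i : 'I_n.+2) (x : simplex R n) :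
  vertex_map (lift i) x = face i x.
Proof.
apply: val_inj; apply/matrixP => i' j; rewrite !mxE.
case: unliftP => [j'|] ->.
  rewrite (big_pred1 j') // => k.
  by rewrite /= (inj_eq (@lift_inj _ i)).
by rewrite big_pred0 // => k; apply/negbTE; rewrite eq_sym neq_lift.
Qed.

Lemma singular_act_continuous m n (u : 'I_m.+1 -> 'I_n.+1)
    (s : singular_simplex R X n) : continuous (fun x => s (vertex_map u x)).
Proof.
by apply: continuous_compose; [exact: cts_fun|exact: vertex_map_continuous].
Qed.

Definition singular_act m n (u : 'I_m.+1 -> 'I_n.+1)
    (s : singular_simplex R X n) : singular_simplex R X m :=
  mkcts (@singular_act_continuous m n u s).

Lemma singular_actE m n (u : 'I_m.+1 -> 'I_n.+1) s x :
  singular_act u s x = s (vertex_map u x).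
Proof. by []. Qed.

Definition sing : vset.
Proof.
refine (@Vset (singular_simplex R X) singular_act _ _).
- by move=> n s; apply/continuousEP => x; rewrite singular_actE vertex_map_id.
- move=> l m n u v s; apply/continuousEP => x.
  by rewrite !singular_actE vertex_map_comp.
Defined.

Lemma simplex_face_act n (i : 'I_n.+2) (s : singular_simplex R X n.+1) :
  simplex_face i s = @act sing _ _ (lift i) s.
Proof.
apply/continuousEP => x; rewrite [RHS]singular_actE vertex_map_lift.
by [].
Qed.

Lemma coboundary_cob n (c : singular_simplex R X n -> rat^o) :
  coboundary c = cob (A := sing) c.
Proof.
apply: funext => s; apply: eq_bigr => i _.
by rewrite simplex_face_act.
Qed.

Lemma cocyclesP n (c : singular_simplex R X n -> rat^o) :
  cocycles c <-> cocycle (A := sing) c.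
Proof.
rewrite /cocycles /= coboundary_cob; split=> [E s|E]; first by rewrite E.
by apply: funext => s; apply: E.
Qed.

Lemma coboundariesP n (c : singular_simplex R X n -> rat^o) :
  coboundaries c <-> exists y, forall s, c s = gcob (A := sing) y s.
Proof.
case: n c => [|n] c /=; split.
- by move=> ->; exists (fun _ _ => 0).
- by move=> [y cy]; apply: funext => s; rewrite cy.
- move=> [d _ <-]; exists (fun p s => extend (T := sing) 0 d s) => s.
  by rewrite coboundary_cob; apply: eq_bigr => i _; rewrite extend_same.
- move=> [y cy]; exists (y n) => //; rewrite coboundary_cob.
  by apply: funext => s; rewrite cy.
Qed.

End SingularVset.

Section CartesianPower.
Variables (X : topologicalType) (r : nat).

Lemma power_coord_continuous (i : 'I_r) :
  continuous (fun x : cartesian_power X r => x i).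
Proof. exact: (@proj_continuous 'I_r (fun=> X) i). Qed.

Lemma continuous_to_power (T : topologicalType) (f : T -> cartesian_power X r) :
  (forall i, continuous (fun t => f t i)) -> continuous f.
Proof.
move=> cf t; apply/cvg_sup => i.
by apply: (@continuous_comp_initial _ _ _ (fun g : 'I_r -> X => g i)); apply: cf.
Qed.

End CartesianPower.

Section CohomologyDim.
Variable R : realType.

Lemma has_dim_quot_dim (K : fieldType) (V : lmodType K) (U W : set V) :
  finite_dim_quot U W -> has_dim_quot U W (dim_quot U W).
Proof. by move=> H; apply: xgetPex. Qed.

Lemma sub_lincombE (T : Type) d (u : T -> rat^o) (a : 'I_d -> rat)
    (e : 'I_d -> T -> rat^o) s :
  (u - \sum_(i < d) a i *: e i) s = u s - \sum_(i < d) a i * e i s.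
Proof. by rewrite addrfctE opprfctE fct_sumE. Qed.

Section HasDim.
Variables (X : topologicalType) (n d : nat) (e : 'I_d -> sing R X n -> rat^o).
Hypothesis e_cocycle : forall i, cocycles (e i).
Hypothesis eP : forall u, cocycles u -> exists! a : 'rV[rat]_d,
  coboundaries (u - \sum_(i < d) a ord0 i *: e i).

Lemma quot_basis_spanning (c : sing R X n -> rat) : cocycle c ->
  exists (l : 'I_d -> rat) y, forall s, c s = \sum_i l i * e i s + gcob y s.
Proof.
move=> /cocyclesP/eP[a [/coboundariesP[y cy] _]]; exists (a ord0), y => s.
by rewrite -cy sub_lincombE addrC subrK.
Qed.

Lemma quot_basis_independent (l : 'I_d -> rat) y :
  (forall s, \sum_i l i * e i s = gcob y s) -> forall i, l i = 0.
Proof.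
move=> ly i.
have /eP[a [_ aP]] : cocycles (0 : sing R X n -> rat^o).
  by apply/cocyclesP => s; rewrite /cob big1 // => j _; rewrite mulr0.
have a0 : a = 0.
  apply: aP; rewrite sub0r big1 ?oppr0 => [|j _]; last by rewrite mxE scale0r.
  by apply/coboundariesP; exists (fun _ _ => 0) => s; rewrite gcob0.
have al : a = \row_i (- l i).
  apply: aP; apply/coboundariesP; exists y => s; rewrite -ly sub_lincombE sub0r -sumrN.
  by apply: eq_bigr => j _; rewrite mxE mulNr opprK.
by have := congr1 (fun b : 'rV_d => - b ord0 i) (etrans (esym al) a0); rewrite !mxE opprK oppr0.
Qed.

End HasDim.

Lemma cohomology_basis (X : topologicalType) :
  (forall k, cohomology_findim R X k) ->
  exists be : forall n, 'I_(cohomology_dim R X n) -> sing R X n -> rat,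
    spanning (I := fun n => 'I_(cohomology_dim R X n)) be /\
    independent (I := fun n => 'I_(cohomology_dim R X n)) be.
Proof.
move=> fd; pose b n := cid (has_dim_quot_dim (fd n)).
exists (fun n => projT1 (b n)); split; first split.
- by move=> n i; apply/cocyclesP; have [+ _] := projT2 (b n).
- by move=> n c; apply: quot_basis_spanning; have [_] := projT2 (b n).
- by move=> n l y; apply: quot_basis_independent; have [_] := projT2 (b n).
Qed.

(** The default value 0 satisfies the bound. Otherwise a basis and the spanning family are expressed
    in each other modulo coboundaries; independence of the basis makes the product of the two
    matrices 1, hence d <= #|I|. *)
Lemma cohomology_dim_le (X : topologicalType) n (I : finType)
    (al : I -> sing R X n -> rat) :
  (forall i, cocycle (al i)) ->
  (forall c : sing R X n -> rat, cocycle c -> exists (l : I -> rat) y,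
    forall s, c s = \sum_i l i * al i s + gcob y s) ->
  (cohomology_dim R X n <= #|I|)%N.
Proof.
move=> Zal Sal; rewrite /cohomology_dim /dim_quot.
case: xgetP => // d _ [e [Ze eP]].
have /choice[L LP] : forall j, exists ly : (I -> rat) * (forall p, sing R X p -> rat),
    forall s, e j s = \sum_i ly.1 i * al i s + gcob ly.2 s.
  by move=> j; have /cocyclesP/Sal[l [y ly]] := Ze j; exists (l, y).
have /choice[M MP] : forall i, exists ly : ('I_d -> rat) * (forall p, sing R X p -> rat),
    forall s, al i s = \sum_j ly.1 j * e j s + gcob ly.2 s.
  by move=> i; have [l [y ly]] := quot_basis_spanning eP (Zal i); exists (l, y).
pose A := \matrix_(j < d, i < #|I|) (L j).1 (enum_val i).
pose B := \matrix_(i < #|I|, j < d) (M (enum_val i)).1 j.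
apply: (@mulmx1_min _ _ _ A B); apply/matrixP => j k; rewrite !mxE.
apply/eqP; rewrite -subr_eq0; apply/eqP; move: k.
apply: (quot_basis_independent eP (y := fun p s =>
  -1 * (\sum_i (L j).1 i * (M i).2 p s + 1 * (L j).2 p s))) => s.
rewrite gcobZ gcobD gcob_sum mul1r.
under eq_bigr => k _ do rewrite mulrBl.
rewrite big_split /= sumrN.
have -> : \sum_(k < d) (j == k)%:R * e k s = e j s.
  rewrite (bigD1 j) //= eqxx mul1r big1 ?addr0 // => k /negbTE.
  by rewrite eq_sym => ->; rewrite mul0r.
have -> : \sum_i gcob (fun p (a : sing R X p) => (L j).1 i * (M i).2 p a) s =
    \sum_i (L j).1 i * (al i s - \sum_k (M i).1 k * e k s).
  by apply: eq_bigr => i _; rewrite gcobZ MP addrC addKr.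
rewrite LP.
under [X in _ = - 1 * (X + _)]eq_bigr do rewrite mulrBr.
rewrite big_split /= sumrN.
have -> : \sum_i (L j).1 i * (\sum_k (M i).1 k * e k s) = \sum_(k < d) (A *m B) j k * e k s.
  under [RHS]eq_bigr do rewrite mxE mulr_suml.
  rewrite exchange_big /= (reindex (fun i : 'I_#|I| => enum_val i)) /=; last exact/onW_bij/enum_val_bij.
  apply: eq_bigr => i _; rewrite mulr_sumr; apply: eq_bigr => k _.
  by rewrite !mxE mulrA.
under [X in _ = -1 * (_ - X + _)]eq_bigr do rewrite mxE.
ring.
Qed.

Definition power_simplex_coords (X : topologicalType) r n
    (s : sing R (cartesian_power X r) n) : powv (sing R X) r n :=
  fun i => mkcts (continuous_compose (@power_coord_continuous X r i) (@cts_fun _ _ s)).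

Lemma power_simplex_continuous (X : topologicalType) r n
    (s : powv (sing R X) r n) :
  continuous ((fun x i => s i x) : simplex R n -> cartesian_power X r).
Proof. by apply: continuous_to_power => i; apply: cts_fun. Qed.

Definition power_simplex (X : topologicalType) r n (s : powv (sing R X) r n) :
  sing R (cartesian_power X r) n := mkcts (@power_simplex_continuous X r n s).

Lemma power_cohomology_dim_le (X : topologicalType) (r n : nat) (P : {poly R}) :
  (forall k, cohomology_findim R X k) ->
  (forall k, P`_k = (cohomology_dim R X k)%:R) ->
  (cohomology_dim R (cartesian_power X r) n)%:R <= (P ^+ r)`_n.
Proof.
move=> fd PE; have [be [sp ind]] := cohomology_basis fd.
have [al sal] := spanning_pow r sp ind.
rewrite -(@card_pow_index _ (fun n => 'I_(cohomology_dim R X n))); last first.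
  by move=> k; rewrite card_ord PE.
pose f := @power_simplex_coords X r; pose g := @power_simplex X r.
have fK m : cancel (f m) (g m).
  by move=> s; apply/continuousEP => x; apply: funext.
have gK m : cancel (g m) (f m).
  by move=> s; apply: funext => i; apply/continuousEP.
have fact k m (u : 'I_k.+1 -> 'I_m.+1) s : f _ (act u s) = act u (f _ s).
  by apply: funext => i; apply/continuousEP.
have [Z S] := spanning_iso fK gK fact sal.
by rewrite ler_nat; apply: cohomology_dim_le (S n).
Qed.

End CohomologyDim.

(** * Singular cohomology in degrees 0 and 1 *)

Section LowDegrees.
Variables (R : realType) (X : topologicalType).

(** A retraction of the line onto the unit interval: paths can be functions on all of R, and maps
    into the interval, the cube and the simplex are defined without membership hypotheses. *)
Definition clamp (t : R) : R := Num.max (Num.min t 1) 0.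

Lemma clamp01 t : 0 <= clamp t <= 1.
Proof. by rewrite /clamp le_max lexx orbT ge_max ler01 ge_min lexx orbT. Qed.

Lemma clamp_id t : 0 <= t <= 1 -> clamp t = t.
Proof. by case/andP=> t0 t1; rewrite /clamp (min_l t1) max_l. Qed.

Lemma clamp_continuous : continuous clamp.
Proof.
move=> t; apply: (@continuous_max _ _ (fun t : R => Num.min t 1) (cst 0));
  last exact: cvg_cst.
apply: (@continuous_min _ _ id (cst 1)); first exact: cvg_id.
exact: cvg_cst.
Qed.

Lemma to_interval_subproof t : clamp t \in unit_interval R.
Proof. by apply/mem_set; rewrite /unit_interval /= in_itv /= clamp01. Qed.

Definition to_interval (t : R) : unit_interval R :=
  exist (fun y => y \in unit_interval R) _ (to_interval_subproof t).

Lemma to_interval_continuous : continuous to_interval.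
Proof. by apply: continuous_set_type; exact: clamp_continuous. Qed.

Lemma to_cube_subproof t : (\row_(i < 1) clamp t) \in cube R 1.
Proof. by apply/mem_set => i; rewrite mxE clamp01. Qed.

Definition to_cube (t : R) : cube R 1 :=
  exist (fun y => y \in cube R 1) _ (to_cube_subproof t).

Lemma to_cube_continuous : continuous to_cube.
Proof.
apply: continuous_set_type; apply: continuous_rV => i /=.
by under eq_fun do rewrite mxE; exact: clamp_continuous.
Qed.

Definition segment_row (t : R) : 'rV[R]_2 :=
  \row_i (if i == ord0 then 1 - clamp t else clamp t).

Lemma to_segment_subproof t : segment_row t \in simplex R 1.
Proof.
have /andP[t0 t1] := clamp01 t.
apply/mem_set; split=> [i|]; first by rewrite mxE; case: ifP => // _; rewrite subr_ge0.
by rewrite !big_ord_recl big_ord0 !mxE /= addr0 subrK.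
Qed.

Definition to_segment (t : R) : simplex R 1 :=
  exist (fun y => y \in simplex R 1) _ (to_segment_subproof t).

Lemma to_segment_continuous : continuous to_segment.
Proof.
apply: continuous_set_type; apply: continuous_rV => i t.
rewrite (_ : (fun t => _) = fun t => if i == ord0 then 1 - clamp t else clamp t);
  last by apply: funext => t' /=; rewrite mxE.
case: (i == ord0); last exact: clamp_continuous.
by apply: cvgB; [exact: cvg_cst|exact: clamp_continuous].
Qed.

Definition affine n (w : 'I_n.+1 -> R) (x : simplex R n) : R :=
  \sum_i w i * \val x ord0 i.

Lemma affine_continuous n (w : 'I_n.+1 -> R) : continuous (affine w).
Proof.
apply: continuous_big => [|i _]; first exact: add_continuous.
apply: (continuous_compose (g := fun t : R => w i * t)); last exact: continuous_coord.
exact: mulrl_continuous.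
Qed.

Lemma affine_vertex_map m n (u : 'I_m.+1 -> 'I_n.+1) (w : 'I_n.+1 -> R) x :
  affine w (vertex_map u x) = affine (w \o u) x.
Proof.
rewrite /affine [RHS](partition_big u xpredT) //=.
apply: eq_bigr => i _; rewrite mxE mulr_sumr.
by apply: eq_bigr => j /eqP ->.
Qed.

(** Edges may be reversed (j < i) or degenerate (i = j). *)
Definition edge (i j : nat) n : 'I_2 -> 'I_n.+1 :=
  fun k => inord (if k == ord0 then i else j).

Lemma affine_edge n (w : nat -> R) i j (x : simplex R 1) :
  (i <= n)%N -> (j <= n)%N ->
  affine (fun k : 'I_n.+1 => w k) (vertex_map (edge i j n) x) =
  w i + \val x ord0 ord_max * (w j - w i).
Proof.
move=> hi hj; rewrite affine_vertex_map /affine !big_ord_recl big_ord0 /=.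
rewrite /edge /= !inordK //.
have [_] := set_mem (valP x); rewrite !big_ord_recl big_ord0 addr0 => E.
rewrite (_ : lift ord0 ord0 = ord_max) in E *; last exact: val_inj.
have -> : \val x ord0 ord0 = 1 - \val x ord0 ord_max by rewrite -E addrK.
ring.
Qed.

Lemma simplex1_coord01 (x : simplex R 1) : 0 <= \val x ord0 ord_max <= 1.
Proof.
have [x0] := set_mem (valP x); rewrite !big_ord_recl big_ord0 addr0 => E.
rewrite (_ : lift ord0 ord0 = ord_max) in E; last exact: val_inj.
by rewrite x0 -E lerDr x0.
Qed.

Lemma to_segmentK (x : simplex R 1) : to_segment (\val x ord0 ord_max) = x.
Proof.
apply: val_inj; apply/matrixP => i j; rewrite (ord1 i) !mxE clamp_id ?simplex1_coord01 //.
have [_] := set_mem (valP x); rewrite !big_ord_recl big_ord0 addr0 => E.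
rewrite (_ : lift ord0 ord0 = ord_max) in E; last exact: val_inj.
case: eqP => [->|/eqP j0]; first by rewrite -E addrK.
by congr (\val x _ _); apply: val_inj; case: j j0 => [[|[|]]].
Qed.

Section Cocycle1.
Variable c : sing R X 1 -> rat.
Hypothesis Zc : cocycle c.

(** This is the cocycle condition on the triangle i, j, k, whose vertices may come in any order and
    coincide. *)
Lemma cocycle_edges n (s : sing R X n) i j k :
  c (act (edge i k n) s) =
  c (act (edge i j n) s) + c (act (edge j k n) s).
Proof.
pose u : 'I_3 -> 'I_n.+1 := fun l => inord (nth 0%N [:: i; j; k] l).
have := Zc (act u s); rewrite /cob !big_ord_recl big_ord0 !actA.
have -> : u \o lift ord0 = edge j k n.
  by apply: funext => -[[|[|]]].
have -> : u \o lift (lift ord0 ord0) = edge i k n.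
  by apply: funext => -[[|[|]]].
have -> : u \o lift (lift ord0 (lift ord0 ord0)) = edge i j n.
  by apply: funext => -[[|[|]]].
rewrite /= /bump /= !(expr0, expr1, exprS) => E.
have -> : c (act (edge i k n) s) = c (act (edge i k n) s) + 0.
  by rewrite addr0.
rewrite -[in LHS]E; ring.
Qed.

Lemma cocycle_edge_refl n (s : sing R X n) i : c (act (edge i i n) s) = 0.
Proof. by have := cocycle_edges s i i i; move/eqP; rewrite -subr_eq0 opprD addNKr oppr_eq0 => /eqP. Qed.

(** A constant 1-simplex equals its own degenerate edge at vertex 0. *)
Lemma cocycle_const (s : sing R X 1) : (forall x y, s x = s y) -> c s = 0.
Proof.
move=> sc; rewrite -(cocycle_edge_refl s 0); congr c.
by apply/continuousEP => x; apply: sc.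
Qed.

End Cocycle1.
Lemma simplex0_eq (x y : simplex R 0) : x = y.
Proof.
have [_] := set_mem (valP x); have [_] := set_mem (valP y).
rewrite !big_ord_recl !big_ord0 !addr0 => y1 x1.
by apply: val_inj; apply/matrixP => i j; rewrite !ord1 x1 y1.
Qed.

Lemma simplex_point_subproof : (\row_(i < 1) (1 : R)) \in simplex R 0.
Proof.
by apply/mem_set; split=> [i|]; rewrite ?big_ord_recl ?big_ord0 mxE ?addr0.
Qed.

Definition simplex_point : simplex R 0 :=
  exist (fun y => y \in simplex R 0) _ simplex_point_subproof.

Definition value0 (s : sing R X 0) : X := s simplex_point.

Lemma value0_inj : injective value0.
Proof.
move=> s t st; apply/continuousEP => x.
by rewrite (simplex0_eq x simplex_point).
Qed.

Lemma value0_face0 (s : sing R X 1) :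
  value0 (act (lift ord0) s) = s (to_segment 1).
Proof.
rewrite /value0 [LHS]singular_actE; congr (s _).
apply: val_inj; apply/matrixP => i j; rewrite !mxE clamp_id ?lexx ?ler01 //.
rewrite big_mkcond big_ord_recl big_ord0 /= addr0 mxE subrr.
by case: j => [[|[|]]].
Qed.

Lemma value0_face1 (s : sing R X 1) :
  value0 (act (lift (lift ord0 ord0)) s) = s (to_segment 0).
Proof.
rewrite /value0 [LHS]singular_actE; congr (s _).
apply: val_inj; apply/matrixP => i j; rewrite !mxE clamp_id ?lexx ?ler01 //.
rewrite big_mkcond big_ord_recl big_ord0 /= addr0 mxE subr0.
by case: j => [[|[|]]].
Qed.

Lemma cob_value0 (c : sing R X 0 -> rat) (s : sing R X 1) :
  cob c s = c (act (lift ord0) s) - c (act (lift (lift ord0 ord0)) s).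
Proof.
rewrite /cob !big_ord_recl big_ord0 addr0 expr0 mul1r; congr (_ + _).
by rewrite /= /bump /= expr1 mulN1r.
Qed.

Lemma sub_path_continuous (g : R -> X) (a b : R) : continuous g ->
  continuous (fun x : simplex R 1 => g (a + \val x ord0 ord_max * (b - a))).
Proof.
move=> cg; apply: (continuous_compose cg).
apply: (continuous_compose (g := fun t : R => a + t * (b - a)));
  last exact: continuous_coord.
move=> t; apply: cvgD; first exact: cvg_cst.
exact: mulrr_continuous.
Qed.

Definition sub_path (g : R -> X) (cg : continuous g) (a b : R) : sing R X 1 :=
  mkcts (@sub_path_continuous g a b cg).

Lemma sub_pathE (g : R -> X) (cg : continuous g) a b x :
  sub_path cg a b x = g (a + \val x ord0 ord_max * (b - a)).
Proof. by []. Qed.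

Lemma sub_path_segment (g : R -> X) (cg : continuous g) a b t : 0 <= t <= 1 ->
  sub_path cg a b (to_segment t) = g (a + t * (b - a)).
Proof. by move=> t01; rewrite sub_pathE mxE /= clamp_id. Qed.

Lemma connecting_path : path_connected R X -> forall x y,
  exists g : R -> X, [/\ continuous g, g 0 = x & g 1 = y].
Proof.
move=> pc x y; have [p pE] := pc x y.
exists (fun t => p (to_interval t)); split.
- by apply: continuous_compose; [exact: cts_fun|exact: to_interval_continuous].
- by have [-> //] := pE (to_interval 0); rewrite /= clamp_id ?lexx ?ler01.
- by have [_ -> //] := pE (to_interval 1); rewrite /= clamp_id ?lexx ?ler01.
Qed.

(** A 0-cocycle takes equal values at the two ends of a path, hence is constant. *)
Lemma cohomology_dim0_le1 : path_connected R X -> (cohomology_dim R X 0 <= 1)%N.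
Proof.
move=> pc; rewrite -(card_ord 1).
apply: (cohomology_dim_le (al := fun (i : 'I_1) s => 1)).
  by move=> i s; rewrite cob_value0 subrr.
move=> c Zc.
have cE s t : c s = c t.
  have [g [cg g0 g1]] := connecting_path pc (value0 s) (value0 t).
  have := Zc (sub_path cg 0 1); rewrite cob_value0.
  have -> : act (lift ord0) (sub_path cg 0 1) = t.
    apply: value0_inj; rewrite value0_face0 sub_path_segment ?lexx ?ler01 //.
    by rewrite add0r mul1r subr0.
  have -> : act (lift (lift ord0 ord0)) (sub_path cg 0 1) = s.
    apply: value0_inj; rewrite value0_face1 sub_path_segment ?lexx ?ler01 //.
    by rewrite add0r mul0r.
  by move/eqP; rewrite subr_eq0 => /eqP.
have [[s0]|ns] := pselect (inhabited (sing R X 0)).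
  exists (fun=> c s0), (fun _ _ => 0) => s.
  by rewrite big_ord_recl big_ord0 /= mulr1 !addr0.
by exists (fun=> 0), (fun _ _ => 0) => s; case: ns; exists.
Qed.

Section NullHomotopicLoop.
Variables (x0 : X) (g : R -> X).
Hypotheses (cg : continuous g) (g0 : g 0 = x0) (g1 : g 1 = x0).
Hypothesis pi1 : forall a b : homotopy_group R x0 1, a = b.

Lemma loop_continuous : continuous (fun x : cube R 1 => g (\val x ord0 ord0)).
Proof. exact: (continuous_compose cg (@continuous_coord _ _ _ _)). Qed.

Lemma loop_subproof :
  (mkcts loop_continuous : continuousType _ _) \in based_map R x0 1.
Proof. by apply/mem_set => x [i]; rewrite (ord1 i) /= /mkcts => -[] ->. Qed.

Lemma cst_subproof :
  (mkcts (fun x => @cst_continuous (cube R 1) X x0 x) : continuousType _ _)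
    \in based_map R x0 1.
Proof. by apply/mem_set. Qed.

(* A null homotopy is a map on the unit square.  Composed with the affine map
   sending the six vertices of a 5-simplex to (0,0), (0,1/2), (0,3/4), (0,1),
   (1,1), (1,0), it gives a singular 5-simplex on whose edges c is additive; c
   vanishes on the edges lying in the last three sides, where the homotopy is
   constant. *)
Lemma cocycle_null_loop (c : sing R X 1 -> rat) : cocycle c ->
  c (sub_path cg 0 2^-1) + c (sub_path cg 2^-1 (3%:R / 4%:R))
    + c (sub_path cg (3%:R / 4%:R) 1) = 0.
Proof.
move=> Zc.
have /homotopy_classP[H [cH H0 H1 Hb]] := pi1
  (\pi_(homotopy_group R x0 1)%qT (exist (fun h => h \in based_map R x0 1) _ loop_subproof))
  (\pi_(homotopy_group R x0 1)%qT (exist (fun h => h \in based_map R x0 1) _ cst_subproof)).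
pose ws : nat -> R := nth 0 [:: 0; 0; 0; 0; 1; 1].
pose wt : nat -> R := nth 0 [:: 0; 2^-1; 3%:R / 4%:R; 1; 1; 0].
pose h (x : simplex R 5) := H (to_interval (affine (fun k : 'I_6 => ws k) x),
                               to_cube (affine (fun k : 'I_6 => wt k) x)).
have ch : continuous h.
  apply: (continuous_compose cH); apply: continuous_pairing.
    exact: (continuous_compose to_interval_continuous (@affine_continuous _ _)).
  exact: (continuous_compose to_cube_continuous (@affine_continuous _ _)).
pose s : sing R X 5 := mkcts ch.
have sE i j x : (i <= 5)%N -> (j <= 5)%N -> act (edge i j 5) s x =
    H (to_interval (ws i + \val x ord0 ord_max * (ws j - ws i)),
       to_cube (wt i + \val x ord0 ord_max * (wt j - wt i))).
  by move=> hi hj; rewrite [LHS]singular_actE -!(@affine_edge 5).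
have bottom i j : (i <= 3)%N -> (j <= 3)%N ->
    act (edge i j 5) s = sub_path cg (wt i) (wt j).
  move=> hi hj; apply/continuousEP => x; rewrite sE; [|lia..].
  have w0 k : (k <= 3)%N -> ws k = 0 by case: k => [|[|[|[|]]]].
  rewrite !w0 // subr0 mulr0 addr0 H0 /=; last by rewrite clamp_id ?lexx ?ler01.
  rewrite /mkcts /= mxE clamp_id //.
  have w01 k : (k <= 3)%N -> 0 <= wt k <= 1.
    by case: k => [|[|[|[|]]]] // _; rewrite /wt /=; apply/andP; split; lra.
  have /andP[x0' x1'] := simplex1_coord01 x.
  have /andP[a0 a1] := w01 _ hi; have /andP[b0 b1] := w01 _ hj.
  by apply/andP; split; nra.
have cst i j : (i <= 5)%N -> (j <= 5)%N ->
    (ws i = 1 /\ ws j = 1) \/ (wt i = wt j /\ (wt i = 0 \/ wt i = 1)) ->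
    c (act (edge i j 5) s) = 0.
  move=> hi hj hw; apply: cocycle_const => // x y.
  suff E z : act (edge i j 5) s z = x0 by rewrite !E.
  rewrite sE //; case: hw => [[-> ->]|[<- hw]].
    rewrite subrr mulr0 addr0 H1 // [LHS]/=.
    by rewrite /to_interval /= clamp_id ?lexx ?ler01.
  rewrite subrr mulr0 addr0 Hb //; exists ord0; rewrite /= mxE.
  by case: hw => ->; rewrite clamp_id ?lexx ?ler01; [left|..|right|].
(* The edge from 0 to 3 is computed twice: as the sum of the three pieces of the loop, and as the
   sum of the edges along the three other sides, where c vanishes. *)
have E1 := cocycle_edges Zc s 0 2 3.
have E2 := cocycle_edges Zc s 0 1 2.
have E3 := cocycle_edges Zc s 0 5 3.
have E4 := cocycle_edges Zc s 5 4 3.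
rewrite -[2^-1]/(wt 1%N) -[3%:R / 4%:R]/(wt 2%N) -[0]/(wt 0%N) -[1]/(wt 3%N).
rewrite -!bottom // -E2 -E1 E3 E4 !cst //; rewrite /wt /ws /=; tauto.
Qed.

End NullHomotopicLoop.
(** The cocycle relation is applied to the triangle 0, 1, 0. *)
Lemma cocycle_sub_path_rev (c : sing R X 1 -> rat) (g : R -> X)
    (cg : continuous g) : cocycle c ->
  c (sub_path cg 1 0) = - c (sub_path cg 0 1).
Proof.
move=> Zc; have := cocycle_edges Zc (sub_path cg 0 1) 0 1 0.
rewrite cocycle_edge_refl //.
have E i j : (i <= 1)%N -> (j <= 1)%N ->
    act (edge i j 1) (sub_path cg 0 1) = sub_path cg i%:R j%:R.
  move=> hi hj; apply/continuousEP => x; rewrite [LHS]singular_actE !sub_pathE.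
  have := affine_edge (fun k => k%:R) x hi hj.
  rewrite /affine !big_ord_recl big_ord0 /= mul0r add0r addr0 mul1r add0r subr0 mulr1.
  move=> <-; congr (g _); rewrite (_ : lift ord0 ord0 = ord_max) //; exact: val_inj.
by rewrite !E // => /esym/eqP; rewrite addr_eq0 => /eqP ->; rewrite opprK.
Qed.

Section ThreePaths.
Variables g1 g2 g3 : R -> X.
Hypotheses (c1 : continuous g1) (c2 : continuous g2) (c3 : continuous g3).
Hypotheses (g12 : g1 1 = g2 0) (g23 : g2 1 = g3 1).

(** The concatenation of g1, g2 and the reverse of g3, with breakpoints 1/2 and 3/4; the second test
    is a shift of the first because [continuous_paste] cuts at 1/2. *)
Definition three_paths (t : R) : X :=
  if t <= 2^-1 then g1 (2%:R * t)
  else if t - 4%:R^-1 <= 2^-1 then g2 (4%:R * t - 2%:R) else g3 (4%:R - 4%:R * t).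

Lemma three_paths_continuous : continuous three_paths.
Proof.
have affc (a b : R) : continuous (fun t : R => a * t + b).
  move=> t; apply: cvgD; last exact: cvg_cst.
  exact: mulrl_continuous.
have c1' : continuous (fun t : R => g1 (2%:R * t)).
  by apply: (continuous_compose c1); exact: mulrl_continuous.
have c2' : continuous (fun t : R => g2 (4%:R * t - 2%:R)).
  by apply: (continuous_compose c2); exact: affc.
have c3' : continuous (fun t : R => g3 (4%:R - 4%:R * t)).
  rewrite (_ : (fun t => _) = fun t => g3 (- 4%:R * t + 4%:R)).
    by apply: (continuous_compose c3); exact: affc.
  by apply: funext => t; rewrite addrC mulNr.
apply: (continuous_paste (r := fun t : R => t)) => //.
- by move=> t; exact: cvg_id.
- apply: (continuous_paste (r := fun t : R => t - 4%:R^-1)) => //.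
    by move=> t; apply: cvgB; [exact: cvg_id|exact: cvg_cst].
  move=> t tE; have -> : t = 3%:R / 4%:R by lra.
  rewrite (_ : _ - _ = 1); last by field.
  by rewrite g23; congr (g3 _); field.
- move=> t ->; rewrite ifT; last by lra.
  by rewrite mulfV ?pnatr_eq0 // g12; congr (g2 _); field.
Qed.

Lemma three_paths_pieces : let cg := three_paths_continuous in
  [/\ sub_path cg 0 2^-1 = sub_path c1 0 1,
      sub_path cg 2^-1 (3%:R / 4%:R) = sub_path c2 0 1 &
      sub_path cg (3%:R / 4%:R) 1 = sub_path c3 1 0].
Proof.
split; apply/continuousEP => x; rewrite !sub_pathE;
  have /andP[x0 x1] := simplex1_coord01 x; move: (\val x _ _) x0 x1 => t t0 t1;
  rewrite /three_paths.
- rewrite ifT; last by lra.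
  by congr (g1 _); field.
- case: ifP => ht.
    have -> : t = 0 by lra.
    rewrite (_ : 2%:R * _ = 1); last by field.
    by rewrite g12 mul0r addr0.
  rewrite ifT; last by lra.
  by congr (g2 _); field.
- rewrite ifF; last by apply/negbTE; rewrite -ltNge; lra.
  case: ifP => ht.
    have -> : t = 0 by lra.
    rewrite (_ : 4%:R * _ - _ = 1); last by field.
    by rewrite g23 mul0r addr0.
  by congr (g3 _); field.
Qed.

End ThreePaths.

(** A primitive of c at a point is the value of c on a chosen path from x0 to it. For a 1-simplex s
    from y to z, the path to y, then s, then the reversed path to z form a null-homotopic loop, so c
    s is the difference of the primitive at z and y. *)
Lemma cohomology_dim1_eq0 : simply_connected R X -> cohomology_dim R X 1 = 0%N.
Proof.
move=> [[x0] pc pi1]; apply/eqP; rewrite -leqn0 -[X in (_ <= X)%N](card_ord 0).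
apply: (cohomology_dim_le (al := fun (i : 'I_0) s => 0)) => [[]//|c Zc].
have /choice[p pP] := connecting_path pc x0.
have cp y : continuous (p y) by have [] := pP y.
exists (fun=> 0), (fun n => if n is 0 as n return sing R X n -> rat then
  fun s => c (sub_path (cp (value0 s)) 0 1) else fun=> 0) => s.
rewrite big_ord0 add0r /= cob_value0 value0_face0 value0_face1.
pose g2 t := s (to_segment t).
have cg2 : continuous g2.
  by apply: continuous_compose; [exact: cts_fun|exact: to_segment_continuous].
have sE : sub_path cg2 0 1 = s.
  by apply/continuousEP => x; rewrite sub_pathE add0r subr0 mulr1 /g2 to_segmentK.
set y := s (to_segment 0); set z := s (to_segment 1).
have [_ py0 py1] := pP y; have [_ pz0 pz1] := pP z.
have [E1 E2 E3] := three_paths_pieces (cp y) cg2 (cp z) py1 (esym pz1).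
have g0 : three_paths (p y) g2 (p z) 0 = x0.
  by rewrite /three_paths ifT ?mulr0 //; lra.
have g1 : three_paths (p y) g2 (p z) 1 = x0.
  rewrite /three_paths ifF; last by apply/negbTE; rewrite -ltNge; lra.
  rewrite ifF; last by apply/negbTE; rewrite -ltNge; lra.
  by rewrite mulr1 subrr.
have := cocycle_null_loop (three_paths_continuous (cp y) cg2 (cp z) py1 (esym pz1))
  g0 g1 (pi1 x0) Zc.
rewrite E1 E2 E3 sE cocycle_sub_path_rev // => /eqP; rewrite subr_eq0 => /eqP <-.
by rewrite addrAC subrr add0r.
Qed.

End LowDegrees.

(** * Rational tensor products of powers *)

Section LinearSpan.
Variables (K : fieldType) (V : lmodType K).
Local Open Scope classical_set_scope.

Record subspace (W : set V) : Prop := Subspace {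
  subspace0 : W 0;
  subspaceD : forall u v, W u -> W v -> W (u + v);
  subspaceZ : forall (k : K) v, W v -> W (k *: v) }.

Lemma subspaceB W u v : subspace W -> W u -> W v -> W (u - v).
Proof. by move=> sW Wu Wv; rewrite -scaleN1r; apply: subspaceD => //; apply: subspaceZ. Qed.

Lemma subspace_sum W (I : Type) (r : seq I) (P : pred I) (F : I -> V) :
  subspace W -> (forall i, P i -> W (F i)) -> W (\sum_(i <- r | P i) F i).
Proof.
move=> sW WF; elim/big_ind: _ => //; first exact: subspace0.
by move=> u v Wu Wv; apply: subspaceD.
Qed.

Lemma linear_span_subspace (S : set V) : subspace (linear_span S).
Proof.
split.
- by exists 0%N, (fun=> 0), (fun=> 0); split=> [[]//|]; rewrite big_ord0.
- move=> _ _ [m [a [s [Ss ->]]]] [n [b [t [St ->]]]].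
  exists (m + n)%N, (fun i => match fintype.split i with inl j => a j | inr j => b j end),
    (fun i => match fintype.split i with inl j => s j | inr j => t j end); split=> [i|].
    by case: (fintype.split i).
  rewrite big_split_ord /=; congr (_ + _); apply: eq_bigr => i _.
    by rewrite (unsplitK (inl i)).
  by rewrite (unsplitK (inr i)).
- move=> k _ [m [a [s [Ss ->]]]]; exists m, (fun i => k * a i), s; split=> //.
  by rewrite scaler_sumr; apply: eq_bigr => i _; rewrite scalerA.
Qed.

Lemma mem_linear_span (S : set V) v : S v -> linear_span S v.
Proof.
move=> Sv; exists 1%N, (fun=> 1), (fun=> v); split=> //.
by rewrite big_ord1 scale1r.
Qed.

(** Expanding e in f and f in e gives two matrices whose product is 1, because the coordinates of
    each e i are unique. *)
Lemma has_dim_quot_le (U W : set V) d d' :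
  subspace W -> has_dim_quot U W d -> has_dim_quot U W d' -> (d <= d')%N.
Proof.
move=> sW [e [Ue eP]] [f [Uf fP]].
have /choice[L LP] i : exists a : 'rV[K]_d', W (e i - \sum_j a ord0 j *: f j).
  by have [a [Wa _]] := fP _ (Ue i); exists a.
have /choice[M MP] j : exists a : 'rV[K]_d, W (f j - \sum_i a ord0 i *: e i).
  by have [a [Wa _]] := eP _ (Uf j); exists a.
pose A := \matrix_(i, j) L i ord0 j; pose B := \matrix_(j, i) M j ord0 i.
apply: (@mulmx1_min _ _ _ A B); apply/row_matrixP => i.
have [a [_ aP]] := eP _ (Ue i).
transitivity a; [symmetry|]; apply: aP.
  have -> : e i - \sum_k row i (A *m B) ord0 k *: e k =
      (e i - \sum_j L i ord0 j *: f j) +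
      \sum_j L i ord0 j *: (f j - \sum_k M j ord0 k *: e k).
    under [X in _ = _ + X]eq_bigr do rewrite scalerBr.
    rewrite big_split /= sumrN addrA subrK; congr (_ - _).
    under [RHS]eq_bigr do rewrite scaler_sumr.
    rewrite exchange_big; apply: eq_bigr => k _ /=.
    rewrite !mxE scaler_suml; apply: eq_bigr => j _.
    by rewrite !mxE scalerA.
  apply: subspaceD => //; apply: subspace_sum => // j _.
  exact: subspaceZ.
rewrite [X in W (_ - X)](_ : _ = e i) ?subrr; first exact: subspace0.
rewrite (bigD1 i) //= !mxE eqxx scale1r big1 ?addr0 // => k ki.
by rewrite !mxE eq_sym (negbTE ki) scale0r.
Qed.

Lemma has_dim_quot_dimE (U W : set V) d :
  subspace W -> has_dim_quot U W d -> dim_quot U W = d.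
Proof.
move=> sW Hd; have Hd' : has_dim_quot U W (dim_quot U W).
  by apply: has_dim_quot_dim; exists d.
by apply/eqP; rewrite eqn_leq (has_dim_quot_le sW Hd' Hd) (has_dim_quot_le sW Hd Hd').
Qed.

Lemma has_dim_quot_fin (I : finType) (U W : set V) (e : I -> V) :
  (forall i, U (e i)) ->
  (forall u, U u -> exists a : I -> K, W (u - \sum_i a i *: e i)) ->
  (forall a b : I -> K, W (\sum_i a i *: e i - \sum_i b i *: e i) -> a = b) ->
  subspace W -> has_dim_quot U W #|I|.
Proof.
move=> Ue span indep sW; exists (fun i => e (enum_val i)); split=> // u Uu.
have sumE (a : 'rV_#|I|) : \sum_i a ord0 i *: e (enum_val i) =
    \sum_i a ord0 (enum_rank i) *: e i.
  rewrite [RHS](reindex (fun i : 'I_#|I| => enum_val i)) /=; last exact/onW_bij/enum_val_bij.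
  by apply: eq_bigr => i _; rewrite enum_valK.
have [a Wa] := span _ Uu; exists (\row_i a (enum_val i)); split.
  rewrite sumE [X in W (_ - X)](_ : _ = \sum_i a i *: e i) //.
  by apply: eq_bigr => i _; rewrite mxE enum_rankK.
move=> b Wb; apply/rowP => i; rewrite mxE.
have -> : a = fun i => b ord0 (enum_rank i).
  apply: indep; rewrite -sumE.
  have -> : \sum_i a i *: e i - \sum_i b ord0 i *: e (enum_val i) =
    (u - \sum_i b ord0 i *: e (enum_val i)) - (u - \sum_i a i *: e i).
    by rewrite opprB [RHS]addrC addrA subrK.
  exact: subspaceB.
by rewrite enum_valK.
Qed.

End LinearSpan.

Section FreeModule.
Variable G : choiceType.
Local Open Scope classical_set_scope.
Implicit Types c d : G -> rat^o.

Lemma finsupp_funP c :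
  finsupp_fun c <-> exists A : {fset G}, forall g, g \notin A -> c g = 0.
Proof.
split=> [/finite_fsetP[A AE]|[A A0]].
  exists A => g gA; apply/eqP/negP => /negP cg; move/negP: gA; apply.
  by have : [set g | c g != 0] g by []; rewrite AE.
apply: (@sub_finite_set _ _ [set` A]); last exact: finite_fset.
by move=> g /= cg; apply/negPn/negP => /A0 /eqP; rewrite (negbTE cg).
Qed.

Lemma finsupp_subspace : subspace (@finsupp_fun G).
Proof.
split.
- by apply/finsupp_funP; exists fset0.
- move=> c d /finsupp_funP[A A0] /finsupp_funP[B B0]; apply/finsupp_funP.
  exists (A `|` B)%fset => g; rewrite inE negb_or => /andP[gA gB].
  by rewrite addrfctE A0 // B0 // addr0.
- move=> k c /finsupp_funP[A A0]; apply/finsupp_funP; exists A => g gA.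
  by rewrite scalrfctE A0 // scaler0.
Qed.

Lemma finsupp_free_gen g : @finsupp_fun G (free_gen g).
Proof.
apply/finsupp_funP; exists [fset g]%fset => h.
by rewrite inE /free_gen => /negbTE ->.
Qed.

Section Extension.
Variables (V : lmodType rat) (f : G -> V).

(** Sums of infinite support are 0 by convention, so linearity is stated for finitely supported
    functions. *)
Definition lin_ext c : V := \sum_(g \in [set: G]) (c g : rat) *: f g.

Lemma lin_extE c (A : {fset G}) : (forall g, g \notin A -> c g = 0) ->
  lin_ext c = \sum_(g <- A) (c g : rat) *: f g.
Proof. by move=> A0; rewrite /lin_ext (fsbigTE A) // => g /A0 ->; rewrite scale0r. Qed.

Lemma lin_ext_free_gen g : lin_ext (free_gen g) = f g.
Proof.
rewrite (@lin_extE _ [fset g]%fset); last first.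
  by move=> h; rewrite inE /free_gen => /negbTE ->.
by rewrite big_seq_fset1 /free_gen eqxx scale1r.
Qed.

Lemma lin_extP (k : rat) c d : finsupp_fun c -> finsupp_fun d ->
  lin_ext (k *: c + d) = k *: lin_ext c + lin_ext d.
Proof.
move=> /finsupp_funP[A A0] /finsupp_funP[B B0].
have A0' g : g \notin (A `|` B)%fset -> c g = 0.
  by rewrite inE negb_or => /andP[/A0].
have B0' g : g \notin (A `|` B)%fset -> d g = 0.
  by rewrite inE negb_or => /andP[_ /B0].
rewrite !(@lin_extE _ (A `|` B)%fset) // => [|g gAB]; last first.
  by rewrite addrfctE scalrfctE A0' // B0' // scaler0 addr0.
rewrite scaler_sumr -big_split /=; apply: eq_bigr => g _.
by rewrite addrfctE scalrfctE scalerDl scalerA.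
Qed.

Lemma lin_extB c d : finsupp_fun c -> finsupp_fun d ->
  lin_ext (c - d) = lin_ext c - lin_ext d.
Proof.
by move=> fc fd; rewrite [c - d]addrC [RHS]addrC -!scaleN1r lin_extP.
Qed.

Lemma lin_ext0 : lin_ext 0 = 0.
Proof. by rewrite (@lin_extE _ fset0) // big_nil. Qed.

Lemma lin_ext_sum (I : Type) (r : seq I) (a : I -> rat) (c : I -> G -> rat^o) :
  (forall i, finsupp_fun (c i)) ->
  lin_ext (\sum_(i <- r) a i *: c i) = \sum_(i <- r) a i *: lin_ext (c i).
Proof.
move=> fc; elim: r => [|i r IH]; first by rewrite !big_nil lin_ext0.
rewrite !big_cons lin_extP // ?IH //.
apply: subspace_sum finsupp_subspace _ => j _.
exact: subspaceZ finsupp_subspace _ _ _.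
Qed.

End Extension.

Lemma finsupp_expand c : finsupp_fun c ->
  exists (s : seq G) (a : G -> rat), c = \sum_(g <- s) a g *: free_gen g.
Proof.
move=> /finsupp_funP[A A0]; exists A, c; apply: funext => h.
rewrite fct_sumE; have [hA|hA] := boolP (h \in A).
  rewrite (big_fsetD1 h) //= big_seq big1 ?addr0.
    by rewrite scalrfctE /free_gen eqxx [RHS]mulr1.
  move=> g; rewrite !inE => /andP[gh _].
  by rewrite scalrfctE /free_gen eq_sym (negbTE gh) scaler0.
rewrite A0 // big_seq big1 // => g gA; rewrite scalrfctE /free_gen.
by case: eqP gA => [<-|_ _]; [rewrite (negbTE hA)|rewrite scaler0].
Qed.

Lemma lin_ext_sub (V : lmodType rat) (W : set V) (f : G -> V) c :
  subspace W -> (forall g, W (f g)) -> finsupp_fun c -> W (lin_ext f c).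
Proof.
move=> sW Wf /finsupp_expand[s [a ->]].
rewrite lin_ext_sum => [|g]; last exact: finsupp_free_gen.
apply: subspace_sum => // g _; rewrite lin_ext_free_gen.
exact: subspaceZ.
Qed.

Lemma lin_ext_id c : finsupp_fun c -> lin_ext (@free_gen G) c = c.
Proof.
move=> /finsupp_expand[s [a ->]].
rewrite lin_ext_sum => [|g]; last exact: finsupp_free_gen.
by apply: eq_bigr => g _; rewrite lin_ext_free_gen.
Qed.

End FreeModule.

Lemma lin_ext_comp (G H : choiceType) (V : lmodType rat) (p : G -> H)
    (f : H -> V) (c : G -> rat^o) : finsupp_fun c ->
  lin_ext f (lin_ext (fun g => free_gen (p g)) c) = lin_ext (fun g => f (p g)) c.
Proof.
move=> /finsupp_expand[s [a ->]].
have fg := @finsupp_free_gen; rewrite [RHS]lin_ext_sum // lin_ext_sum //.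
under eq_bigr do rewrite lin_ext_free_gen.
rewrite lin_ext_sum //; apply: eq_bigr => g _.
by rewrite !lin_ext_free_gen.
Qed.

Lemma lin_ext_relators (G : choiceType) (mul : G -> G -> G) (V : lmodType rat)
    (W : set V) (f : G -> V) (c : G -> rat^o) :
  subspace W -> (forall g h, W (f (mul g h) - f g - f h)) ->
  rat_relators mul c -> W (lin_ext f c).
Proof.
move=> sW Wf [n [a [s [Ss ->]]]].
have rel_ext u : (exists g h, u = free_gen (mul g h) - free_gen g - free_gen h) ->
    finsupp_fun u /\ W (lin_ext f u).
  move=> [g [h ->]]; have fs := finsupp_subspace G.
  have fg := @finsupp_free_gen G.
  have f1 : @finsupp_fun G (free_gen (mul g h) - free_gen g) by apply: subspaceB.
  split; first exact: subspaceB.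
  by rewrite !lin_extB // !lin_ext_free_gen.
rewrite lin_ext_sum => [|i]; last by have [] := rel_ext _ (Ss i).
apply: subspace_sum => // i _; apply: subspaceZ => //.
by have [] := rel_ext _ (Ss i).
Qed.

Section TensorPower.
Variables (G H : choiceType) (mulG : G -> G -> G) (mulH : H -> H -> H).
Variables (r : nat) (e : G) (eH : H) (pr : 'I_r -> H -> G) (inj : 'I_r -> G -> H).
Hypothesis mule : forall g, mulG g e = g.
Hypothesis emul : forall g, mulG e g = g.
Hypothesis pr_mul : forall i h h', pr i (mulH h h') = mulG (pr i h) (pr i h').
Hypothesis pr_inj : forall i j g, pr i (inj j g) = if i == j then g else e.
Hypothesis pr_unit : forall i, pr i eH = e.
Hypothesis pr_ext : forall h h', (forall i, pr i h = pr i h') -> h = h'.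

Let relG := rat_relators mulG.
Let relH := rat_relators mulH.
Let sG : subspace relG := linear_span_subspace _.
Let sH : subspace relH := linear_span_subspace _.

Lemma free_gen_mul (A : choiceType) (mul : A -> A -> A) g h :
  rat_relators mul (free_gen (mul g h) - free_gen g - free_gen h).
Proof. by apply: mem_linear_span; exists g, h. Qed.

(** For an idempotent u the relation [u u] = [u] + [u] forces [u] = 0. *)
Lemma free_gen_unit (A : choiceType) (mul : A -> A -> A) u : mul u u = u ->
  rat_relators mul (free_gen u).
Proof.
move=> uu; have := free_gen_mul mul u u; rewrite uu subrr sub0r => W.
by rewrite -[free_gen u]opprK -scaleN1r; apply: subspaceZ (linear_span_subspace _) _ _ _.
Qed.

Lemma inj_mul i g g' : inj i (mulG g g') = mulH (inj i g) (inj i g').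
Proof.
by apply: pr_ext => j; rewrite pr_mul !pr_inj; case: eqP => //; rewrite mule.
Qed.

(* Multiplies the images inj i (pr i h) together one at a time: the partial
   products agree with h in the coordinates treated so far. *)
Lemma free_gen_decompose h :
  relH (free_gen h - \sum_i free_gen (inj i (pr i h))).
Proof.
suff [hr [hrE]] : exists hk, (forall i : 'I_r, pr i hk = if (i < r)%N then pr i h else e) /\
    relH (free_gen hk - \sum_(i < r | (i < r)%N) free_gen (inj i (pr i h))).
  rewrite (_ : hr = h); last by apply: pr_ext => i; rewrite hrE ltn_ord.
  by congr (relH (_ - _)); apply: eq_bigl => i; rewrite ltn_ord.
suff decomp k : (k <= r)%N -> exists hk,
    (forall i : 'I_r, pr i hk = if (i < k)%N then pr i h else e) /\
    relH (free_gen hk - \sum_(i < r | (i < k)%N) free_gen (inj i (pr i h))).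
  exact: decomp.
elim: k => [_|k IH kr].
  exists eH; split=> [i|]; first by rewrite pr_unit.
  rewrite big_pred0 // subr0; apply: free_gen_unit.
  by apply: pr_ext => i; rewrite pr_mul pr_unit mule.
have [hk [hkE Whk]] := IH (ltnW kr).
pose o := Ordinal kr; pose t := inj o (pr o h).
exists (mulH hk t); split=> [i|].
  rewrite pr_mul hkE pr_inj [(i < k.+1)%N]ltnS [(i <= k)%N]leq_eqVlt; have [->|io] := eqVneq i o.
    by rewrite /= ltnn !eqxx emul.
  rewrite mule (_ : (i == k :> nat) = false) //; apply/negbTE.
  by apply: contra_neq io => E; apply: val_inj.
rewrite (bigD1 o) //= -/t.
have -> : \sum_(i < r | (i < k.+1)%N && (i != o)) free_gen (inj i (pr i h)) =
    \sum_(i < r | (i < k)%N) free_gen (inj i (pr i h)).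
  apply: eq_bigl => i; rewrite ltnS ltn_neqAle andbC; congr (_ && _).
have -> : free_gen (mulH hk t) - (free_gen t +
    \sum_(i < r | (i < k)%N) free_gen (inj i (pr i h))) =
  (free_gen (mulH hk t) - free_gen hk - free_gen t) +
  (free_gen hk - \sum_(i < r | (i < k)%N) free_gen (inj i (pr i h))).
  by rewrite [RHS]addrACA subrK opprD.
by apply: subspaceD => //; apply: free_gen_mul.
Qed.

(** The basis consists of the images [I_ i (b j)]. They span because u is the sum of the
    [I_ i (P_ i u)] modulo relators, by [free_gen_decompose]; they are independent because [P_ i]
    after [I_ i'] is the identity for i' = i and 0 modulo relators otherwise. *)
Lemma rat_tensor_power_basis d :
  has_dim_quot (@finsupp_fun G) relG d ->
  has_dim_quot (@finsupp_fun H) relH (r * d).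
Proof.
move=> [b [fb bP]].
pose I_ i c := lin_ext (fun g => free_gen (inj i g)) c.
pose P_ i c := lin_ext (fun h => free_gen (pr i h)) c.
have sfG := finsupp_subspace G; have sfH := finsupp_subspace H.
have fI i c : finsupp_fun c -> finsupp_fun (I_ i c).
  by apply: lin_ext_sub => // g; apply: finsupp_free_gen.
have fP i c : finsupp_fun c -> finsupp_fun (P_ i c).
  by apply: lin_ext_sub => // g; apply: finsupp_free_gen.
have relI i c : relG c -> relH (I_ i c).
  by apply: lin_ext_relators => // g h; rewrite inj_mul; apply: free_gen_mul.
have relP i c : relH c -> relG (P_ i c).
  by apply: lin_ext_relators => // g h; rewrite pr_mul; apply: free_gen_mul.
have <- : #|{: 'I_r * 'I_d}| = (r * d)%N by rewrite card_prod !card_ord.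
apply: (has_dim_quot_fin (e := fun ij : 'I_r * 'I_d => I_ ij.1 (b ij.2))) => //.
- by move=> ij; apply: fI.
- move=> u fu.
  have /choice[a aP] i : exists a : 'rV[rat]_d,
      relG (P_ i u - \sum_j a ord0 j *: b j).
    by have [a [Wa _]] := bP _ (fP i u fu); exists a.
  exists (fun ij => a ij.1 ord0 ij.2).
  rewrite -(pair_bigA _ (fun i j => a i ord0 j *: I_ i (b j))) /=.
  have -> : u - \sum_i \sum_j a i ord0 j *: I_ i (b j) =
      (u - \sum_i I_ i (P_ i u)) +
      \sum_i I_ i (P_ i u - \sum_j a i ord0 j *: b j).
    have E i : I_ i (P_ i u - \sum_j a i ord0 j *: b j) =
        I_ i (P_ i u) - \sum_j a i ord0 j *: I_ i (b j).
      have fS : finsupp_fun (\sum_j a i ord0 j *: b j).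
        by apply: subspace_sum => // j _; apply: subspaceZ.
      rewrite /I_ lin_extB //; last exact: fP.
      by congr (_ - _); apply: lin_ext_sum.
    under [X in _ = _ + X]eq_bigr do rewrite E.
    by rewrite big_split /= sumrN addrA subrK.
  apply: subspaceD => //; last by apply: subspace_sum => // i _; apply: relI.
  have -> : u - \sum_i I_ i (P_ i u) =
      lin_ext (fun h => free_gen h - \sum_i free_gen (inj i (pr i h))) u.
    have {1}-> : u = lin_ext (@free_gen H) u by rewrite lin_ext_id.
    under eq_bigr do rewrite /I_ /P_ lin_ext_comp //.
    have /finsupp_funP[A A0] := fu.
    rewrite (lin_extE _ A0) (lin_extE _ A0).
    under eq_bigr do rewrite (lin_extE _ A0).
    rewrite exchange_big -sumrB; apply: eq_bigr => h _ /=.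
    by rewrite scalerBr scaler_sumr.
  apply: lin_ext_sub => // h; exact: free_gen_decompose.
move=> a a' W; apply: funext => -[i j].
have {W} W : relG (\sum_j (a (i, j) - a' (i, j)) *: b j).
  have := relP i _ W.
  rewrite -sumrB; under eq_bigr do rewrite -scalerBl.
  rewrite /P_ lin_ext_sum => [|ij]; last exact: fI.
  have -> : \sum_ij (a ij - a' ij) *:
        lin_ext (fun h => free_gen (pr i h)) (I_ ij.1 (b ij.2)) =
      \sum_i' \sum_k (a (i', k) - a' (i', k)) *:
        lin_ext (fun h => free_gen (pr i h)) (I_ i' (b k)).
    by rewrite pair_bigA /=; apply: eq_bigr => -[].
  rewrite (bigD1 i) //=.
  set S1 := (X in X + _); set S2 := (X in _ + X) => W12.
  (* For i' different from i, coordinate i of an image of [inj i'] is the unit e, whose generator is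
     a combination of relators. *)
  have W2 : relG S2.
    apply: subspace_sum => // i' i'i; apply: subspace_sum => // k _.
    apply: subspaceZ => //; rewrite /I_ lin_ext_comp //.
    apply: lin_ext_sub => // g; rewrite pr_inj eq_sym (negbTE i'i).
    by apply: free_gen_unit; rewrite mule.
  have -> : \sum_j (a (i, j) - a' (i, j)) *: b j = S1 + S2 - S2.
    rewrite addrK; apply: eq_bigr => k _; congr (_ *: _).
    rewrite /I_ lin_ext_comp // -[LHS]lin_ext_id //; congr lin_ext.
    by apply: funext => g; rewrite pr_inj eqxx.
  exact: subspaceB.
have [z [_ zP]] := bP 0 (subspace0 sfG).
have z0 : z = 0.
  apply: zP; rewrite sub0r big1 ?oppr0 => [|k _]; last by rewrite mxE scale0r.
  exact: subspace0.
have zW : z = \row_k - (a (i, k) - a' (i, k)).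
  apply: zP; rewrite sub0r -sumrN.
  under eq_bigr do rewrite mxE scaleNr opprK.
  exact: W.
have := congr1 (fun v : 'rV_d => v ord0 j) (etrans (esym zW) z0).
by rewrite !mxE => /eqP; rewrite oppr_eq0 subr_eq0 => /eqP.
Qed.

End TensorPower.

(** * Homotopy groups of powers *)

Section HomotopyUnit.
Variables (R : realType) (X : topologicalType) (x0 : X).

Lemma based_mapP k (f g : based_map R x0 k) :
  (forall x, \val f x = \val g x) -> f = g.
Proof. by move=> fg; apply: val_inj; apply/continuousEP. Qed.

Lemma mk_based_subproof k (f : cube R k -> X) (cf : continuous f) :
  (forall x, cube_boundary x -> f x = x0) ->
  (mkcts cf : continuousType _ _) \in based_map R x0 k.
Proof. by move=> fb; apply/mem_set. Qed.

Definition mk_based k (f : cube R k -> X) (cf : continuous f)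
    (fb : forall x, cube_boundary x -> f x = x0) : based_map R x0 k :=
  exist (fun h => h \in based_map R x0 k) _ (mk_based_subproof cf fb).

Definition based_cst k : based_map R x0 k :=
  @mk_based k (fun=> x0) (fun x => @cst_continuous (cube R k) X x0 x) (fun _ _ => erefl).

Definition homotopy_unit k : homotopy_group R x0 k :=
  \pi_(homotopy_group R x0 k)%qT (based_cst k).

Section Reparametrize.
Variables (h : R -> R) (k : nat).
Hypotheses (h01 : forall t, 0 <= t <= 1 -> 0 <= h t <= 1).
Hypotheses (ch : continuous h) (h0 : h 0 = 0) (h1 : h 1 = 1).

(** The straight-line homotopy from the reparametrization by h, at s = 0, to the identity, at s = 1.
    It stays in the cube by convexity and preserves the boundary since h fixes 0 and 1. *)
Lemma mix_subproof (sx : unit_interval R * cube R k.+1) :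
  \row_i (if i == ord0 then (1 - \val sx.1) * h (\val sx.2 ord0 i)
                            + \val sx.1 * \val sx.2 ord0 i
          else \val sx.2 ord0 i) \in cube R k.+1.
Proof.
case: sx => s x /=; apply/mem_set => i; rewrite mxE; have xi := set_mem (valP x) i.
case: ifP => // _; have /andP[a0 a1] := h01 xi; have /andP[b0 b1] := xi.
have := set_mem (valP s); rewrite /unit_interval /= in_itv /= => /andP[s0 s1].
by apply/andP; split; nra.
Qed.

Definition mix sx : cube R k.+1 :=
  exist (fun y => y \in cube R k.+1) _ (mix_subproof sx).

Lemma continuous_mulr (T : topologicalType) (f g : T -> R) :
  continuous f -> continuous g -> continuous (fun t => f t * g t).
Proof. by move=> cf cg t; apply: cvgM; [exact: cf|exact: cg]. Qed.

Lemma mix_continuous : continuous mix.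
Proof.
apply: continuous_set_type; apply: continuous_rV => i.
have c1 : continuous (fun sx : unit_interval R * cube R k.+1 => \val sx.1).
  exact: (continuous_compose (@continuous_val _ _) (@continuous_fst _ _)).
have c2 j : continuous (fun sx : unit_interval R * cube R k.+1 => \val sx.2 ord0 j).
  exact: (continuous_compose (@continuous_coord _ _ _ _) (@continuous_snd _ _)).
have [->|i0] := eqVneq i ord0; last first.
  under eq_fun do rewrite mxE (negbTE i0).
  exact: c2.
under eq_fun do rewrite mxE eqxx.
move=> sx; apply: cvgD; last exact: (continuous_mulr c1 (c2 _)).
apply: (@continuous_mulr _ (fun sx : unit_interval R * cube R k.+1 => 1 - \val sx.1)
  (fun sx => h (\val sx.2 ord0 ord0))); last exact: (continuous_compose ch (c2 _)).
by move=> t; apply: cvgB; [exact: cvg_cst|exact: c1].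
Qed.

Lemma reparametrize_homotopic (f g : based_map R x0 k.+1) :
  (forall x, \val g x = \val f (cube_map h01 x)) -> based_homotopic g f.
Proof.
move=> gf; exists (fun sx => \val f (mix sx)); split.
- by apply: continuous_compose; [exact: cts_fun|exact: mix_continuous].
- move=> s x s0; rewrite gf; congr (\val f _); apply: val_inj.
  apply/matrixP => i j; rewrite !mxE /= s0 subr0 mul1r mul0r addr0.
  by [].
- move=> s x s1; congr (\val f _); apply: val_inj.
  apply/matrixP => i j; rewrite !mxE /= s1 subrr mul1r mul0r add0r (ord1 i).
  by case: ifP.
- move=> s x [i xi]; apply: (set_mem (valP f)); exists i; rewrite /= mxE /=.
  case: ifP => _ //; case: xi => ->; rewrite ?h0 ?h1; [left|right]; lra.
Qed.

End Reparametrize.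

(** A product with the constant map on the right is the reparametrization by [lhalf]: on the second
    half [lhalf] is 1, where based maps take the value x0. *)
Lemma homotopy_mulr1 k (a : homotopy_group R x0 k.+1) :
  homotopy_mul a (homotopy_unit k.+1) = a.
Proof.
rewrite -[a]reprK homotopy_mulE; apply/homotopy_classP.
apply: (reparametrize_homotopic (h01 := @lhalf01 R) (@lhalf_continuous R) (@lhalf0 R)).
  by rewrite /lhalf min_r // lerDr.
move=> x; rewrite concatE; case: leP => // xh.
rewrite [LHS]/=; symmetry; apply: (set_mem (valP (repr a))).
exists ord0; right; rewrite cube_map0 /lhalf min_r //; lra.
Qed.

Lemma homotopy_mul1r k (a : homotopy_group R x0 k.+1) :
  homotopy_mul (homotopy_unit k.+1) a = a.
Proof.
rewrite -[a]reprK homotopy_mulE; apply/homotopy_classP.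
apply: (reparametrize_homotopic (h01 := @rhalf01 R) (@rhalf_continuous R) _ (@rhalf1 R)).
  by rewrite /rhalf max_r // addr0 sub0r oppr_le0.
move=> x; rewrite concatE; case: leP => // xh.
rewrite [LHS]/=; symmetry; apply: (set_mem (valP (repr a))).
exists ord0; left; rewrite cube_map0 /rhalf max_r //; lra.
Qed.

End HomotopyUnit.

Section HomotopyPower.
Variables (R : realType) (X : topologicalType) (x0 : X) (r : nat).
Let Y := cartesian_power X r.
Let y0 : Y := diag_point x0 r.

Lemma coord_based_continuous k (i : 'I_r) (f : based_map R y0 k) :
  continuous (fun x => \val f x i).
Proof.
exact: (continuous_compose (@power_coord_continuous X r i) (@cts_fun _ _ (\val f))).
Qed.

Lemma coord_based_boundary k (i : 'I_r) (f : based_map R y0 k) x :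
  cube_boundary x -> \val f x i = x0.
Proof. by move=> xb; rewrite (set_mem (valP f)). Qed.

Definition coord_based k i (f : based_map R y0 k) : based_map R x0 k :=
  mk_based (@coord_based_continuous k i f) (@coord_based_boundary k i f).

Lemma incl_based_continuous k (j : 'I_r) (g : based_map R x0 k) :
  continuous ((fun x i => if i == j then \val g x else x0) : cube R k -> Y).
Proof.
apply: continuous_to_power => i; case: (i == j); last by move=> x; exact: cst_continuous.
exact: cts_fun.
Qed.

Lemma incl_based_boundary k (j : 'I_r) (g : based_map R x0 k) x :
  cube_boundary x -> (fun i => if i == j then \val g x else x0) = y0.
Proof.
by move=> xb; apply: funext => i; rewrite (set_mem (valP g)) // if_same.
Qed.

Definition incl_based k j (g : based_map R x0 k) : based_map R y0 k :=
  mk_based (@incl_based_continuous k j g) (@incl_based_boundary k j g).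

Definition coord_class k i (a : homotopy_group R y0 k) : homotopy_group R x0 k :=
  \pi_(homotopy_group R x0 k)%qT (coord_based i (repr a)).

Definition incl_class k j (a : homotopy_group R x0 k) : homotopy_group R y0 k :=
  \pi_(homotopy_group R y0 k)%qT (incl_based j (repr a)).

Lemma coord_class_pi k i (f : based_map R y0 k) :
  coord_class i (\pi_(homotopy_group R y0 k)%qT f) =
  \pi_(homotopy_group R x0 k)%qT (coord_based i f).
Proof.
apply/homotopy_classP.
have /homotopy_classP[H [cH H0 H1 Hb]] := reprK (\pi_(homotopy_group R y0 k)%qT f).
exists (fun sx => H sx i); split.
- exact: (continuous_compose (@power_coord_continuous X r i) cH).
- by move=> s x s0; rewrite H0.
- by move=> s x s1; rewrite H1.
- by move=> s x xb; rewrite Hb.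
Qed.

(** Homotopies chosen for each coordinate assemble into one homotopy in the product. *)
Lemma coord_class_ext k (a b : homotopy_group R y0 k) :
  (forall i, coord_class i a = coord_class i b) -> a = b.
Proof.
move=> ab; rewrite -[a]reprK -[b]reprK; apply/homotopy_classP.
have /choice[H HP] i : exists H : unit_interval R * cube R k -> X,
    [/\ continuous H,
        forall (s : unit_interval R) x, \val s = 0 -> H (s, x) = \val (repr a) x i,
        forall (s : unit_interval R) x, \val s = 1 -> H (s, x) = \val (repr b) x i &
        forall s x, cube_boundary x -> H (s, x) = x0].
  by have /homotopy_classP := ab i.
exists (fun sx i => H i sx); split.
- by apply: continuous_to_power => i; have [] := HP i.
- by move=> s x s0; apply: funext => i; have [_ ->] := HP i.
- by move=> s x s1; apply: funext => i; have [_ _ ->] := HP i.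
- by move=> s x xb; apply: funext => i; have [_ _ _ ->] := HP i.
Qed.

Lemma coord_class_mul k i (a b : homotopy_group R y0 k.+1) :
  coord_class i (homotopy_mul a b) =
  homotopy_mul (coord_class i a) (coord_class i b).
Proof.
rewrite homotopy_mulE coord_class_pi; congr (\pi_(homotopy_group R x0 k.+1)%qT _).
apply: based_mapP => x; rewrite !concatE /= /mkcts /concat_fun.
by case: ifP.
Qed.

Lemma coord_class_unit k i : coord_class i (homotopy_unit R y0 k) = homotopy_unit R x0 k.
Proof.
by rewrite coord_class_pi; congr (\pi_(homotopy_group R x0 k)%qT _); apply: based_mapP.
Qed.

Lemma coord_incl_class k i j (a : homotopy_group R x0 k) :
  coord_class i (incl_class j a) = if i == j then a else homotopy_unit R x0 k.
Proof.
rewrite coord_class_pi; case: eqP => [->|/eqP/negbTE ij].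
  rewrite -[RHS]reprK; congr (\pi_(homotopy_group R x0 k)%qT _).
  by apply: based_mapP => x; rewrite /= /mkcts eqxx.
congr (\pi_(homotopy_group R x0 k)%qT _).
by apply: based_mapP => x; rewrite /= /mkcts ij.
Qed.

Lemma homotopy_dim_power k :
  homotopy_findim R x0 k -> homotopy_dim R y0 k = (r * homotopy_dim R x0 k)%N.
Proof.
case: k => [|k] fd; first by rewrite /= muln0.
apply: has_dim_quot_dimE; first exact: linear_span_subspace.
apply: (rat_tensor_power_basis (e := homotopy_unit R x0 k.+1)
  (eH := homotopy_unit R y0 k.+1) (pr := @coord_class k.+1)
  (inj := @incl_class k.+1)).
- exact: homotopy_mulr1.
- exact: homotopy_mul1r.
- exact: coord_class_mul.
- exact: coord_incl_class.
- exact: coord_class_unit.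
- exact: coord_class_ext.
exact: has_dim_quot_dim.
Qed.

End HomotopyPower.

(** * Poincare polynomials *)

Section PoincarePolynomials.
Variable R : realType.

(** Infinitely many positive dimensions would make the partial sums unbounded. *)
Lemma finite_total_dim_eventually0 (findim : nat -> Prop) (dim : nat -> nat) :
  finite_total_dim findim dim -> exists N, forall k, (N <= k)%N -> dim k = 0%N.
Proof.
move=> [_ [N NP]]; apply: contrapT => infinite.
have large j : exists m, (j <= \sum_(k < m) dim k)%N.
  elim: j => [|j [m jm]]; first by exists 0%N.
  have [k mk dk] : exists2 k, (m <= k)%N & dim k != 0%N.
    apply: contrapT => H; apply: infinite; exists m => k mk.
    by apply/eqP/negPn/negP => dk; apply: H; exists k.
  exists k.+1; rewrite big_ord_recr /= -addn1 leq_add ?lt0n //.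
  apply: leq_trans jm _.
  rewrite -!(big_mkord xpredT dim) [leqRHS](big_cat_nat (n := m)) //=.
  exact: leq_addr.
by have [m] := large N.+1; rewrite leqNgt ltnS NP.
Qed.

Lemma gen_polyE (a : nat -> nat) N : (forall k, (N <= k)%N -> a k = 0%N) ->
  forall k, (gen_poly R a)`_k = (a k)%:R.
Proof.
move=> a0; apply: (@xgetPex _ 0 [set p : {poly R} | forall k, p`_k = (a k)%:R]%classic).
exists (\poly_(i < N) (a i)%:R) => k; rewrite coef_poly.
by case: ltnP => // /a0 ->.
Qed.

Lemma horner_split2 (p : {poly R}) x :
  p.[x] = p`_0 + p`_1 * x + \sum_(2 <= i < (size p).-1.+1) p`_i * x ^+ i.
Proof.
rewrite (horner_coef_wide x (leqSpred (size p))) -(big_mkord xpredT (fun i => p`_i * x ^+ i)).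
(* For a constant polynomial, 0 included, the sum from 2 is empty and the linear coefficient is
   0. *)
case E : (size p).-1 => [|m].
  rewrite big_nat1 big_geq // addr0 expr0 mulr1 [p`_1]nth_default ?mul0r ?addr0 //.
  by move: E; case: (size p) => [|[]].
by rewrite big_ltn // big_ltn // addrA expr0 mulr1 expr1.
Qed.

Lemma horner_le (p q : {poly R}) x : 0 <= x -> (forall k, p`_k <= q`_k) ->
  p.[x] <= q.[x].
Proof.
move=> x0 pq.
rewrite (horner_coef_wide x (leq_maxl (size p) (size q))).
rewrite (horner_coef_wide x (leq_maxr (size p) (size q))).
by apply: ler_sum => i _; rewrite ler_wpM2r ?exprn_ge0.
Qed.

Lemma horner_ge0 (p : {poly R}) x : 0 <= x -> (forall k, 0 <= p`_k) -> 0 <= p.[x].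
Proof. by move=> x0 p0; rewrite -(horner0 x); apply: horner_le => // k; rewrite coef0. Qed.

(* If the cohomology of the power had no Poincare polynomial, the left side would
   be 0 by convention, so nothing has to be proved about its finiteness. *)
Lemma poincare_power_le (X : topologicalType) (r : nat) (x : R) : 0 <= x ->
  finite_total_dim (cohomology_findim R X) (cohomology_dim R X) ->
  (poincare_poly R (cartesian_power X r)).[x] <= (poincare_poly R X).[x] ^+ r.
Proof.
move=> x0 ftd; have [N N0] := finite_total_dim_eventually0 ftd.
have PE := gen_polyE N0; rewrite -horner_exp.
rewrite {1}/poincare_poly /gen_poly; case: xgetP => [p _ pE|_].
  apply: horner_le => // k; rewrite pE.
  by apply: power_cohomology_dim_le => //; have [] := ftd.
rewrite horner0 horner_exp exprn_ge0 // horner_ge0 // => k.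
by rewrite PE.
Qed.

Lemma homotopical_poincare_power (X : topologicalType) (x0 : X) (r : nat) (x : R) :
  finite_total_dim (homotopy_findim R x0) (homotopy_dim R x0) ->
  (homotopical_poincare_poly R (diag_point x0 r)).[x] =
  r%:R * (homotopical_poincare_poly R x0).[x].
Proof.
move=> ftd; have [N N0] := finite_total_dim_eventually0 ftd.
have dimE k := homotopy_dim_power r (ftd.1 k).
rewrite -hornerZ; congr (_.[x]); apply/polyP => k; rewrite coefZ.
rewrite !(@gen_polyE _ N) => [|j Nj|j Nj]; last 2 first.
- by rewrite N0 // if_same.
- by rewrite dimE N0 // muln0 if_same.
by case: ifP => _; rewrite ?dimE ?natrM ?mulr0.
Qed.

End PoincarePolynomials.

Unset Implicit Arguments.

Theorem corollary1p6 (R : realType) (X : topologicalType) (x0 : X)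
    (X_elliptic : rationally_elliptic R X)
    (eps : R) (eps_gt0 : 0 < eps)
    (pp : nat) (ppE : is_stabilization_threshold x0 eps pp)
    (r : nat) (pp_le_r : (pp <= r)%N) :
  let n := (size (homotopical_poincare_poly R x0)).-1 in
  let l := (size (poincare_poly R X)).-1 in
  r%:R * (\sum_(2 <= i < n.+1) (homotopy_dim R x0 i)%:R * eps ^+ i)
    < (1 + \sum_(2 <= i < l.+1) (cohomology_dim R X i)%:R * eps ^+ i) ^+ r
    :> R.
Proof.
cbv zeta; set n := (size (homotopical_poincare_poly R x0)).-1.
set l := (size (poincare_poly R X)).-1.
have [sc hft cft] := X_elliptic; have [_ dom _] := ppE.
have eps_ge0 := ltW eps_gt0.
have [N N0] := finite_total_dim_eventually0 cft.
have [M M0] := finite_total_dim_eventually0 (hft x0).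
pose hd k := if (2 <= k)%N then homotopy_dim R x0 k else 0%N.
have PE : forall k, (poincare_poly R X)`_k = (cohomology_dim R X k)%:R := gen_polyE R N0.
have QE : forall k, (homotopical_poincare_poly R x0)`_k = (hd k)%:R.
  by apply: (@gen_polyE R hd M) => k Mk; rewrite /hd M0 // if_same.
(* The homotopical polynomial has no terms in degrees 0 and 1, so the sum from 2 is its value at
   [eps]. *)
have -> : \sum_(2 <= i < n.+1) (homotopy_dim R x0 i)%:R * eps ^+ i =
    (homotopical_poincare_poly R x0).[eps].
  rewrite horner_split2 !QE mul0r !add0r; apply: eq_big_nat => i /andP[i2 _].
  by rewrite QE /hd i2.
rewrite -homotopical_poincare_power //.
apply: lt_le_trans (dom r pp_le_r eps (lexx _)) _.
apply: le_trans (poincare_power_le r eps_ge0 cft) _.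
have P_ge0 : 0 <= (poincare_poly R X).[eps] by apply: horner_ge0 => // k; rewrite PE.
have P_le : (poincare_poly R X).[eps] <=
    1 + \sum_(2 <= i < l.+1) (cohomology_dim R X i)%:R * eps ^+ i.
  rewrite horner_split2 !PE cohomology_dim1_eq0 // mul0r addr0 lerD //.
    have [_ pc _] := sc; rewrite -[X in _ <= X]/(1%:R) ler_nat.
    exact: cohomology_dim0_le1.
  by rewrite le_eqVlt; apply/orP; left; apply/eqP/eq_bigr => i _; rewrite PE.
by apply: lerXn2r => //; rewrite nnegrE // (le_trans P_ge0).
Qed.
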